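(* Let $(\Phi_t)$ be a KMS-symmetric quantum Markov semigroup on $M_n(\mathbb C)$ and let $\mathcal L$ denote its generator. There exist a Hilbert space $\mathcal H$, a unital $\ast$-homomorphism $\pi_l\colon M_n(\mathbb C)\to B(\mathcal H)$, a unital $\ast$-antihomomorphism $\pi_r\colon M_n(\mathbb C)\to B(\mathcal H)$, an anti-linear isometric involution $\mathcal J\colon\mathcal H\to\mathcal H$ and a linear map $\delta\colon M_n(\mathbb C)\to\mathcal H$ satisfying (i) $\pi_l(A)\pi_r(B)=\pi_r(B)\pi_l(A)$ for all $A,B\in M_n(\mathbb C)$, (ii) $\mathcal J(\pi_l(A)\pi_r(B)\xi)=\pi_l(B)^\ast\pi_r(A)^\ast\mathcal J\xi$ for all $A,B\in M_n(\mathbb C)$ and $\xi\in\mathcal H$, (iii) $\delta(A^\ast)=\mathcal J\delta(A)$ for all $A\in M_n(\mathbb C)$, (iv) $\delta(AB)=\pi_l(\sigma_{-i/4}(A))\delta(B)+\pi_r(\sigma_{i/4}(B))\delta(A)$ for all $A,B\in M_n(\mathbb C)$, (v) $\mathcal H=\mathrm{lin}\{\pi_l(A)\delta(B)\mid A,B\in M_n(\mathbb C)\}$, such that $$\langle A,\mathcal L(B)\rangle_\rho=\langle\delta(A),\delta(B)\rangle_{\mathcal H}$$ for all $A,B\in M_n(\mathbb C)$.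
   Context: Fix an invertible density matrix $\rho\in M_n(\mathbb C)$ (positive, trace $1$). The KMS inner product is $\langle A,B\rangle_\rho=\mathrm{tr}(A^\ast\rho^{1/2}B\rho^{1/2})$; inner products are linear in the second argument. A linear map on $M_n(\mathbb C)$ is KMS-symmetric if it is self-adjoint with respect to $\langle\cdot,\cdot\rangle_\rho$. For $z\in\mathbb C$, $\sigma_z(A)=\rho^{iz}A\rho^{-iz}$ for $A\in M_n(\mathbb C)$. A quantum Markov semigroup on $M_n(\mathbb C)$ is a family $(\Phi_t)_{t\ge0}$ of unital completely positive maps on $M_n(\mathbb C)$ with $\Phi_0=\mathrm{id}$, $\Phi_s\Phi_t=\Phi_{s+t}$ for all $s,t\ge0$, and $\lim_{t\to0}\|\Phi_t-\mathrm{id}\|=0$. Its generator is $\mathcal L=\lim_{t\to0}\frac1t(\mathrm{id}-\Phi_t)$, so $\Phi_t=e^{-t\mathcal L}$. It is KMS-symmetric if every $\Phi_t$ is KMS-symmetric. *)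

(* Defs.v *)
From HB Require Import structures.
From mathcomp Require Import all_boot all_order all_algebra.
From mathcomp Require Import sesquilinear spectral complex.
From mathcomp Require Import all_classical all_reals all_analysis.

Set Implicit Arguments.
Unset Strict Implicit.
Unset Printing Implicit Defensive.

Import Order.TTheory GRing.Theory Num.Theory.
Import numFieldNormedType.Exports.

Local Open Scope classical_set_scope.
Local Open Scope complex_scope.
Local Open Scope sesquilinear_scope.
Local Open Scope ring_scope.

(* In R[i], [0 <= z] means that z is real and nonnegative, so [psd A] forces A
   to be Hermitian. *)
Definition psd (R : realType) (n : nat) (A : 'M[R[i]]_n) : Prop :=
  forall v : 'cV[R[i]]_n, 0 <= (v ^t* *m A *m v) 0 0.

Definition density (R : realType) (n : nat) (rho : 'M[R[i]]_n) : Prop :=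
  psd rho /\ \tr rho = 1.

Definition cexp (R : realType) (z : R[i]) : R[i] :=
  (expR (complex.Re z))%:C
  * (cos (complex.Im z) +i* sin (complex.Im z)).

(* Functional calculus of a normal matrix: [spectralmx A] is unitary and
   A = (spectralmx A)^-1 diag(spectral_diag A) (spectralmx A). *)
Definition mxfun (R : realType) (n : nat) (f : R[i] -> R[i]) (A : 'M[R[i]]_n) :
    'M[R[i]]_n :=
  invmx (spectralmx A) *m diag_mx (map_mx f (spectral_diag A))
  *m spectralmx A.

(* rho^z for rho positive definite; the eigenvalues of such a rho are positive
   reals, hence equal to their real parts. *)
Definition mxpow (R : realType) (n : nat) (rho : 'M[R[i]]_n) (z : R[i]) :
    'M[R[i]]_n :=
  mxfun (fun x => cexp (z * (ln (complex.Re x))%:C)) rho.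

Definition sigma (R : realType) (n : nat) (rho : 'M[R[i]]_n) (z : R[i])
    (A : 'M[R[i]]_n) : 'M[R[i]]_n :=
  mxpow rho ('i%C * z) *m A *m mxpow rho (- ('i%C * z)).

Definition kms (R : realType) (n : nat) (rho A B : 'M[R[i]]_n) : R[i] :=
  \tr (A ^t* *m mxpow rho (2%:R^-1) *m B *m mxpow rho (2%:R^-1)).

Definition kms_symmetric (R : realType) (n : nat) (rho : 'M[R[i]]_n)
    (T : 'M[R[i]]_n -> 'M[R[i]]_n) : Prop :=
  forall A B, kms rho (T A) B = kms rho A (T B).

(* id_{M_k} (x) T on M_k(M_n), a matrix in M_k(M_n) being a k x k matrix of
   n x n blocks. *)
Definition amplification (R : realType) (n k : nat)
    (T : 'M[R[i]]_n -> 'M[R[i]]_n)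
    (X : 'M[R[i]]_(\sum_(i < k) n)) : 'M[R[i]]_(\sum_(i < k) n) :=
  mxblock (fun i j : 'I_k => T (submxblock X i j)).

Definition completely_positive (R : realType) (n : nat)
    (T : 'M[R[i]]_n -> 'M[R[i]]_n) : Prop :=
  forall (k : nat) (X : 'M[R[i]]_(\sum_(i < k) n)),
    psd X -> psd (amplification T X).

(* Operator norm of a linear map; the supremum is that of a nonempty bounded
   set whenever V is finite-dimensional and NV, NW are norms. *)
Definition opnorm (R : realType) (V W : lmodType R[i]) (NV : V -> R)
    (NW : W -> R) (T : V -> W) : R :=
  sup [set NW (T x) | x in [set x | NV x <= 1]].

Definition cvnorm (R : realType) (n : nat) (v : 'cV[R[i]]_n) : R :=
  Num.sqrt (complex.Re ((v ^t* *m v) 0 0)).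

Definition mxopnorm (R : realType) (n : nat) (A : 'M[R[i]]_n) : R :=
  opnorm (@cvnorm R n) (@cvnorm R n) (fun v => A *m v).

Definition supernorm (R : realType) (n : nat)
    (T : 'M[R[i]]_n -> 'M[R[i]]_n) : R :=
  opnorm (@mxopnorm R n) (@mxopnorm R n) T.

(* Only the values Phi t with 0 <= t matter. *)
Definition quantum_markov_semigroup (R : realType) (n : nat)
    (Phi : R -> {linear 'M[R[i]]_n -> 'M[R[i]]_n}) : Prop :=
  [/\ forall t, 0 <= t -> Phi t 1%:M = 1%:M /\ completely_positive (Phi t),
      forall A, Phi 0 A = A,
      forall s t, 0 <= s -> 0 <= t -> forall A, Phi s (Phi t A) = Phi (s + t) A
    & supernorm (fun A => Phi t A - A) @[t --> 0^'+] --> (0 : R)].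

Definition is_generator (R : realType) (n : nat)
    (Phi : R -> {linear 'M[R[i]]_n -> 'M[R[i]]_n})
    (L : {linear 'M[R[i]]_n -> 'M[R[i]]_n}) : Prop :=
  supernorm (fun A => (t^-1)%:C *: (A - Phi t A) - L A) @[t --> 0^'+]
    --> (0 : R).

Definition ip_norm (R : realType) (V : lmodType R[i]) (ip : V -> V -> R[i])
    (x : V) : R :=
  Num.sqrt (complex.Re (ip x x)).

Definition ip_complete (R : realType) (V : lmodType R[i])
    (ip : V -> V -> R[i]) : Prop :=
  forall u : nat -> V,
    (forall e : R, 0 < e -> exists N : nat, forall p q : nat,
       (N <= p)%N -> (N <= q)%N -> ip_norm ip (u p - u q) < e) ->
    exists l : V, forall e : R, 0 < e -> exists N : nat, forall p : nat,
       (N <= p)%N -> ip_norm ip (u p - l) < e.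

(* The inner product is linear in the second argument. *)
Record hilbertSpace (R : realType) := HilbertSpace {
  hilbert_sort :> lmodType R[i];
  hip : hilbert_sort -> hilbert_sort -> R[i];
  hip_linear : forall (a : R[i]) (x y z : hilbert_sort),
    hip x (a *: y + z) = a * hip x y + hip x z;
  hip_conj : forall x y : hilbert_sort, hip y x = Num.conj (hip x y);
  hip_ge0 : forall x : hilbert_sort, 0 <= hip x x;
  hip_eq0 : forall x : hilbert_sort, hip x x = 0 -> x = 0;
  hip_complete : ip_complete hip }.

Definition hnorm (R : realType) (H : hilbertSpace R) (x : H) : R :=
  ip_norm (@hip R H) x.

Definition bounded_operator (R : realType) (H : hilbertSpace R)
    (T : H -> H) : Prop :=
  (forall (a : R[i]) (x y : H), T (a *: x + y) = a *: T x + T y) /\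
  (exists M : R, forall x : H, hnorm (T x) <= M * hnorm x).

(* The adjoint operator; for bounded T it exists by Riesz representation and is
   unique (see adjointP), so the default value of xget is never used. *)
Definition adjoint (R : realType) (H : hilbertSpace R) (T : H -> H) : H -> H :=
  xget T [set S : H -> H | forall x y : H, hip (S x) y = hip x (T y)].

Lemma adjointP (R : realType) (H : hilbertSpace R) (T S : H -> H) :
  (forall x y : H, hip (S x) y = hip x (T y)) -> adjoint T = S.
Proof.
move=> hS; apply: xget_subset1 => // S1 S2 h1 h2.
apply/funext => x; apply/eqP; rewrite -subr_eq0; apply/eqP/hip_eq0.
set w := S1 x - S2 x.
have hw y : hip y w = 0.
  rewrite /w addrC -scaleN1r hip_linear (hip_conj (S1 x)) (hip_conj (S2 x)).
  by rewrite (h1 x y) (h2 x y) mulN1r addNr.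
exact: hw.
Qed.

Definition unital_star_map (R : realType) (n : nat) (H : hilbertSpace R)
    (p : 'M[R[i]]_n -> H -> H) : Prop :=
  [/\ forall A, bounded_operator (p A),
      forall (a : R[i]) A B x, p (a *: A + B) x = a *: p A x + p B x,
      forall x, p 1%:M x = x
    & forall A x, p (A ^t*) x = adjoint (p A) x].

Definition unital_star_hom (R : realType) (n : nat) (H : hilbertSpace R)
    (p : 'M[R[i]]_n -> H -> H) : Prop :=
  unital_star_map p /\ forall A B x, p (A *m B) x = p A (p B x).

Definition unital_star_antihom (R : realType) (n : nat) (H : hilbertSpace R)
    (p : 'M[R[i]]_n -> H -> H) : Prop :=
  unital_star_map p /\ forall A B x, p (A *m B) x = p B (p A x).

Definition antilinear_isometric_involution (R : realType) (H : hilbertSpace R)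
    (J : H -> H) : Prop :=
  [/\ forall (a : R[i]) x y, J (a *: x + y) = Num.conj a *: J x + J y,
      forall x, hnorm (J x) = hnorm x
    & forall x, J (J x) = x].

Definition lin (R : realType) (V : lmodType R[i]) (S : set V) : set V :=
  [set x | exists (m : nat) (c : 'I_m -> R[i]) (v : 'I_m -> V),
     (forall k, S (v k)) /\ x = \sum_(k < m) c k *: v k].

(* Main.v *)
From HB Require Import structures.
Require Import Defs.
From mathcomp Require Import all_boot all_order all_algebra.
From mathcomp Require Import sesquilinear spectral complex.
From mathcomp Require Import all_classical all_reals all_analysis.
From mathcomp Require Import ring.

Set Implicit Arguments.
Unset Strict Implicit.
Unset Printing Implicit Defensive.

Import Order.TTheory GRing.Theory Num.Theory.
Import numFieldNormedType.Exports.
Import ComplexField.Normc.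

(** Write A' for the adjoint of A, S for the square root of rho, so that the
    KMS form is tr(A' S B S), and [w, A] = wA - Aw.  The theorem amounts to the
    formula
      tr(A' S L(B) S) = sum_j tr([w_j, A]' S [w_j, B] S),  w_j Hermitian,
    for the generator.  Given it, let q = rho^(1/4) and put
    delta(A)_j = q [w_j, A] q, a family of matrices with its Hilbert-Schmidt
    inner product, on which M_n acts by left and right multiplication and
    J x = (- x_j')_j; then delta satisfies the twisted Leibniz rule because
    A -> [w_j, A] is a derivation and q conjugates as sigma at -i/4 and i/4
    do.  The Hilbert space is the span of all A delta(B), which the Leibniz
    rule makes stable under the right action ([bimodule_realization]).

    To find the w_j ([sum_of_square_commutators]), work in an eigenbasis of rho,
    so that S = diag(s) and Delta(x) = S x S^-1 multiplies the entry x_kl by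
    d_kl = s_k / s_l.  Regard a map T on M_n as a sesquilinear form on M_n
    through its Choi matrix, where the map B -> v' B v corresponds to |v><v|.
    Complete positivity of the semigroup makes the Choi matrix c of -L positive
    on traceless matrices.  For Hermitian w_j, the terms of the sum of squares
    that have B between two factors w form minus a map with Choi matrix
    D X + X D, where X = sum_j |w_j><w_j| and D is the operator Delta.  So one
    solves the Lyapunov equation D X + X D = c, which amounts to dividing the
    entry c_pq by d_p + d_q, and compresses X to traceless matrices.
    The result is positive: if v is an eigenvector for mu then
    2 mu <v, D v> = <v, (D X + X D) v> >= 0 and D > 0 ([lyapunov_psd]).  KMS
    symmetry of L makes X invariant under w -> w', whence its Hermitian
    decomposition ([lyapunov_kraus]).

    The squares so obtained agree with L up to a map B -> K B + B G.  Both
    kill the identity, so the difference is an inner derivation; it preserves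
    adjoints and is KMS symmetric, and such a derivation vanishes
    ([kms_symmetric_inner_derivation_eq0]).

    The required properties of L, namely L(1) = 0, L(A') = L(A)', KMS symmetry
    and conditional complete negativity, pass to the limit from the difference
    quotients of the semigroup, since the norm of maps on M_n controls each
    matrix entry ([supernorm_entry]). *)

Local Open Scope sesquilinear_scope.
Local Open Scope ring_scope.

(** * Adjoints, traces and matrix units *)

Section Adj.
Variable C : numClosedFieldType.

Lemma linear_fun_morph (V W : lmodType C) (f : V -> W) :
  (forall a x y, f (a *: x + y) = a *: f x + f y) ->
  [/\ f 0 = 0, forall x y, f (x + y) = f x + f y
    & forall a x, f (a *: x) = a *: f x].
Proof.
move=> fl.
have f0 : f 0 = 0.
  have := fl 1 0 0; rewrite scaler0 addr0 scale1r => h.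
  by apply: (addrI (f 0)); rewrite -h addr0.
split=> // [x y|a x]; first by rewrite -[x]scale1r fl !scale1r.
by rewrite -[a *: x]addr0 fl f0 addr0.
Qed.

Lemma adjmxE m n (A : 'M[C]_(m, n)) i j : (A ^t*) i j = Num.conj (A j i).
Proof. by rewrite !mxE. Qed.

Lemma adjmxM m n p (A : 'M[C]_(m, n)) (B : 'M[C]_(n, p)) :
  (A *m B) ^t* = B ^t* *m A ^t*.
Proof. by rewrite trmx_mul map_mxM. Qed.

Lemma adjmxB m n (A B : 'M[C]_(m, n)) : (A - B) ^t* = A ^t* - B ^t*.
Proof. by rewrite linearB map_mxB. Qed.

Lemma adjmxD m n (A B : 'M[C]_(m, n)) : (A + B) ^t* = A ^t* + B ^t*.
Proof. by rewrite linearD map_mxD. Qed.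

Lemma adjmxZ m n a (A : 'M[C]_(m, n)) : (a *: A) ^t* = Num.conj a *: A ^t*.
Proof. by rewrite linearZ map_mxZ. Qed.

Lemma adjmxN m n (A : 'M[C]_(m, n)) : (- A) ^t* = - A ^t*.
Proof. by rewrite linearN map_mxN. Qed.

Lemma adjmx1 n : (1%:M : 'M[C]_n) ^t* = 1%:M.
Proof. by rewrite trmx1 map_mx1. Qed.

Lemma adjmx_sum m n I (r : seq I) (P : pred I) (F : I -> 'M[C]_(m, n)) :
  (\sum_(i <- r | P i) F i) ^t* = \sum_(i <- r | P i) (F i) ^t*.
Proof. by rewrite linear_sum map_mx_sum. Qed.

Lemma mxtrace_adj n (A : 'M[C]_n) : \tr (A ^t*) = Num.conj (\tr A).
Proof. by rewrite rmorph_sum; apply: eq_bigr => i _; rewrite !mxE. Qed.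

Lemma adj_diag_mx n (d : 'rV[C]_n) : (forall i, 0 < d 0 i) ->
  (diag_mx d) ^t* = diag_mx d.
Proof.
move=> dp; apply/matrixP => i j; rewrite !mxE rmorphMn /=.
by have [->|ne] := eqVneq i j; rewrite ?eqxx ?(negPf ne) 1?eq_sym ?(negPf ne) //
  ?mulr1n ?mulr0n // geC0_conj // ltW.
Qed.

Lemma mul_delta_mxE m n p q (A : 'M[C]_(m, n)) k l (B : 'M[C]_(p, q)) a b :
  (A *m delta_mx k l *m B) a b = A a k * B l b.
Proof.
rewrite mxE (bigD1 l) //= big1 ?addr0 => [|i il]; rewrite mxE (bigD1 k) //= big1.
- by rewrite addr0 mxE !eqxx mulr1.
- by move=> i ik; rewrite mxE (negPf ik) mulr0.
- by rewrite addr0 mxE (negPf il) andbF mulr0 mul0r.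
- by move=> j jk; rewrite mxE (negPf jk) mulr0.
Qed.

Lemma mxtrace_delta n (A : 'M[C]_n) k l : \tr (A *m delta_mx k l) = A l k.
Proof.
rewrite /mxtrace (bigD1 l) //= big1 ?addr0 => [|i il].
  by rewrite -[A *m _]mulmx1 mul_delta_mxE mxE eqxx mulr1.
by rewrite -[A *m _]mulmx1 mul_delta_mxE mxE eq_sym (negPf il) mulr0.
Qed.

Lemma mxtrace_inj n (A B : 'M[C]_n) :
  (forall X, \tr (X *m A) = \tr (X *m B)) -> A = B.
Proof.
move=> h; apply/matrixP => i j.
by move: (h (delta_mx j i)); rewrite ![\tr (delta_mx _ _ *m _)]mxtrace_mulC !mxtrace_delta.
Qed.

(** Each eigenvector v of Y, with eigenvalue mu, gives
    v' (D Y + Y D) v = 2 mu v' D v, where v' is the adjoint of v, and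
    v' D v > 0; so mu >= 0. *)
Lemma lyapunov_psd N (d : 'rV[C]_N) (Y : 'M[C]_N) :
  (forall i, 0 < d 0 i) -> Y ^t* = Y ->
  (forall v : 'cV[C]_N, 0 <= (v ^t* *m (diag_mx d *m Y + Y *m diag_mx d) *m v) 0 0) ->
  exists W : 'M[C]_N, Y = W *m W ^t*.
Proof.
move=> dp hY pos.
have Yh : Y \is hermsymmx.
  by apply/is_hermitianmxP; rewrite expr0 scale1r.
have /orthomx_spectralP := hermitian_normalmx Yh.
set U := spectralmx Y; set m := spectral_diag Y => eY.
have Uu : U \is unitarymx by apply: spectral_unitarymx.
have UU : U *m U ^t* = 1%:M by apply/unitarymxP.
have eY' : Y = U ^t* *m diag_mx m *m U by rewrite -invmx_unitary.
have YU : Y *m U ^t* = U ^t* *m diag_mx m by rewrite {1}eY' -!mulmxA UU mulmx1.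
have mreal i : m 0 i \is Num.real.
  by have /mxOverP := hermitian_spectral_diag_real Yh; apply.
have m_ge0 i : 0 <= m 0 i.
  pose v := U ^t* *m delta_mx i (0 : 'I_1).
  have Yv : Y *m v = m 0 i *: v.
    rewrite /v mulmxA YU -mulmxA scalemxAr; congr (_ *m _).
    apply/matrixP => a b; rewrite mul_diag_mx !mxE.
    by have [->|] := eqVneq a i; rewrite //= !mulr0.
  have vY : v ^t* *m Y = m 0 i *: v ^t*.
    by rewrite -{1}hY -adjmxM Yv adjmxZ conj_Creal ?mreal.
  have := pos v; rewrite mulmxDr mulmxDl.
  rewrite !mulmxA vY -!mulmxA -scalemxAl Yv -!scalemxAr -mulr2n -scaler_nat scalerA.
  rewrite mxE pmulr_lge0.
    by rewrite pmulr_rge0 // ltr0n.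
  rewrite mulmxA mxE.
  have vn : v != 0.
    apply/eqP => v0; have : (U *m v) i 0 = 0 by rewrite v0 mulmx0 mxE.
    by rewrite /v mulmxA UU mul1mx mxE !eqxx; apply/eqP/oner_neq0.
  have [k vk] : exists k, v k 0 != 0.
    apply/existsP; apply: contra_neqT vn => /existsPn h.
    by apply/matrixP => a b; rewrite ord1 [RHS]mxE; apply/eqP; have := h a; rewrite negbK.
  have tp j : 0 <= (v ^t* *m diag_mx d) 0 j * v j 0.
    rewrite mul_mx_diag mxE adjmxE mulrAC.
    by rewrite mulr_ge0 ?(ltW (dp _)) // mulrC mul_conjC_ge0.
  rewrite (bigD1 k) //= ltr_wpDr ?sumr_ge0 //.
  rewrite mul_mx_diag mxE adjmxE mulrAC pmulr_lgt0 //.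
  by rewrite mulrC mul_conjC_gt0.
pose sq := \row_i sqrtC (m 0 i).
exists (U ^t* *m diag_mx sq).
rewrite adjmxM trmxCK mulmxA -(mulmxA _ (diag_mx sq)) {1}eY'.
congr (_ *m _ *m _); apply/matrixP => a b.
rewrite mul_diag_mx !mxE rmorphMn /=.
have [->|ne] := eqVneq a b; last by rewrite !mulr0n mulr0.
by rewrite !mulr1n geC0_conj ?sqrtC_ge0 // -expr2 sqrtCK.
Qed.
End Adj.

(** * The Lyapunov equation for Choi matrices *)

Section Lyap.
Variables (C : numClosedFieldType) (n : nat) (s : 'I_n -> C).
Hypothesis s_gt0 : forall i, 0 < s i.
Local Notation T := ('I_n * 'I_n)%type.
Local Notation N := #|{: T}|.
Let d (p : T) := s p.1 / s p.2.
Let sw (p : T) := (p.2, p.1).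

Let d_gt0 p : 0 < d p. Proof. by rewrite divr_gt0. Qed.

Let sum_enum_val (F : T -> C) : \sum_(i < N) F (enum_val i) = \sum_p F p.
Proof. by rewrite -(big_enum_val F) /=; apply: eq_bigl => p; rewrite inE. Qed.

Let sum_diag_pair (F : T -> C) :
  \sum_p (p.1 == p.2)%:R * F p = \sum_m F (m, m).
Proof.
transitivity (\sum_i \sum_j (i == j)%:R * F (i, j)).
  by rewrite pair_bigA; apply: eq_bigr => -[].
apply: eq_bigr => i _.
rewrite (bigD1 i) //= eqxx mul1r big1 ?addr0 // => j /negPf ji.
by rewrite eq_sym ji mul0r.
Qed.

Lemma compress_lyapunov m (D P X : 'M[C]_m) : P *m D = D *m P ->
  D *m (P *m X *m P) + P *m X *m P *m D = P *m (D *m X + X *m D) *m P.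
Proof.
by move=> PD; rewrite mulmxDr mulmxDl !mulmxA PD -!mulmxA PD !mulmxA.
Qed.

(** The form c is the Choi matrix of a KMS symmetric map, and is a positive
    form on traceless matrices; the terms in g and h are what compressing to
    traceless matrices discards, and correspond to maps B -> K B + B G.
    The compression P commutes with D, because the identity matrix is a fixed
    vector of D, so it may be applied to the solution X instead of to c.  The
    symmetry of c under p -> sw p carries over to X, since
    d_p d_q / (d_p + d_q) = 1 / (d_(sw p) + d_(sw q)). *)
Lemma lyapunov_kraus (c : T -> T -> C) : (0 < n)%N ->
  (forall p q, c q p = Num.conj (c p q)) ->
  (forall p q, c p q = d p * d q * Num.conj (c (sw p) (sw q))) ->
  (forall y : T -> C, \sum_m y (m, m) = 0 ->
     0 <= \sum_p \sum_q Num.conj (y p) * c p q * y q) ->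
  exists (I : finType) (w : I -> 'M[C]_n) (g h : T -> C),
    (forall j, (w j) ^t* = w j) /\
    (forall p q, \sum_j w j p.1 p.2 * Num.conj (w j q.1 q.2) * (d p + d q) =
       c p q + (p.1 == p.2)%:R * h q + g p * (q.1 == q.2)%:R).
Proof.
move=> n_gt0 c_herm c_kms c_ccp.
pose E (i : 'I_N) : T := enum_val i.
pose D : 'rV[C]_N := \row_i d (E i).
pose X : 'M[C]_N := \matrix_(i, j) (c (E i) (E j) / (d (E i) + d (E j))).
(* [e] is the identity matrix as a vector, [P] the projection orthogonal to it. *)
pose e : 'cV[C]_N := \col_i ((E i).1 == (E i).2)%:R.
pose P : 'M[C]_N := 1%:M - n%:R^-1 *: (e *m e^T).
have dd0 p q : d p + d q != 0 by rewrite gt_eqF // addr_gt0 ?d_gt0.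
have dconj p : Num.conj (d p) = d p by rewrite geC0_conj ?ltW ?d_gt0.
have D_gt0 i : 0 < D 0 i by rewrite mxE d_gt0.
have X_herm : X ^t* = X.
  apply/matrixP => i j; rewrite !mxE rmorphM fmorphV rmorphD /= !dconj -c_herm.
  by rewrite [d (E j) + _]addrC.
have DX : diag_mx D *m X + X *m diag_mx D = \matrix_(i, j) c (E i) (E j).
  apply/matrixP => i j; rewrite mxE mul_diag_mx mul_mx_diag !mxE.
  by field; apply: dd0.
have De : diag_mx D *m e = e.
  apply/matrixP => i j; rewrite mul_diag_mx !mxE.
  have [eq|_] := eqVneq; last by rewrite mulr0.
  by rewrite mulr1 /d eq divff // gt_eqF.
have eD : e^T *m diag_mx D = e^T.
  by rewrite -[diag_mx D]tr_diag_mx -trmx_mul De.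
have PD : P *m diag_mx D = diag_mx D *m P.
  rewrite /P mulmxBl mulmxBr mul1mx mulmx1 -scalemxAl -scalemxAr.
  by rewrite -mulmxA eD mulmxA De.
have e_conj : e ^t* = e^T.
  by apply/matrixP => i j; rewrite !mxE conjC_nat.
have eT_conj : (e^T) ^t* = e by rewrite -e_conj trmxCK.
have P_herm : P ^t* = P.
  by rewrite adjmxB adjmx1 adjmxZ adjmxM e_conj eT_conj fmorphV rmorph_nat.
have eTe : e^T *m e = n%:R%:M.
  apply/matrixP => i j; rewrite !ord1 mxE [RHS]mxE eqxx mulr1n.
  under eq_bigr do rewrite !mxE.
  rewrite (sum_enum_val (fun p => (p.1 == p.2)%:R * (p.1 == p.2)%:R)) sum_diag_pair.
  under eq_bigr do rewrite eqxx.
  by rewrite sumr_const card_ord.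
have eP : e^T *m P = 0.
  rewrite /P mulmxBr mulmx1 -scalemxAr mulmxA eTe mul_scalar_mx scalerA mulVf ?scale1r ?subrr //.
  by rewrite pnatr_eq0 -lt0n.
pose Y := P *m X *m P.
have Y_herm : Y ^t* = Y.
  by rewrite /Y !adjmxM P_herm X_herm mulmxA.
have [W eW] : exists W : 'M[C]_N, Y = W *m W ^t*.
  apply: (lyapunov_psd D_gt0 Y_herm) => v.
  have -> : v ^t* *m (diag_mx D *m Y + Y *m diag_mx D) *m v =
      (P *m v) ^t* *m (diag_mx D *m X + X *m diag_mx D) *m (P *m v).
    by rewrite adjmxM P_herm (compress_lyapunov X PD) !mulmxA.
  rewrite DX.
  pose y p := (P *m v) (enum_rank p) 0.
  have y0 : \sum_m y (m, m) = 0.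
    have : (e^T *m (P *m v)) 0 0 = 0 by rewrite mulmxA eP mul0mx mxE.
    move=> h; apply: (etrans _ h); rewrite mxE -sum_diag_pair -sum_enum_val; apply: eq_bigr => i _.
    by rewrite [e^T _ _]mxE [e _ _]mxE /y enum_valK.
  move: (c_ccp _ y0); congr (0 <= _).
  rewrite -sum_enum_val mxE.
  under [RHS]eq_bigr do rewrite mxE mulr_suml.
  rewrite exchange_big -sum_enum_val; apply: eq_bigr => i _.
  apply: eq_bigr => j _.
  by rewrite /y !enum_valK adjmxE [X in _ = _ * X * _]mxE.
have YE : exists g h : T -> C, forall p q,
    Y (enum_rank p) (enum_rank q) = c p q / (d p + d q)
      + (p.1 == p.2)%:R * h q + g p * (q.1 == q.2)%:R.
  pose G := - n%:R^-1 *: (X *m e); pose H := - n%:R^-1 *: (e^T *m (X *m P)).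
  exists (fun p => G (enum_rank p) 0), (fun q => H 0 (enum_rank q)) => p q.
  have -> : Y = X + e *m H + G *m e^T.
    rewrite /Y /G /H -mulmxA {1}/P mulmxBl mul1mx.
    rewrite -scalemxAl -scalemxAr -scalemxAl !scaleNr -!mulmxA addrAC; congr (_ - _).
    by rewrite /P mulmxBr mulmx1 -scalemxAr.
  rewrite mxE [X in X + _]mxE [X in _ + X + _]mxE big_ord1 [X in _ + _ + X]mxE big_ord1.
  by rewrite ![X _ _]mxE ![e _ _]mxE ![e^T _ _]mxE ![e _ _]mxE /E !enum_rankK.
pose sg i := enum_rank (sw (E i)).
have swK : involutive sw by case.
have sgK : involutive sg by move=> i; rewrite /sg /E enum_rankK swK enum_valK.
have Y_swap i j : Y i j = Num.conj (Y (sg i) (sg j)).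
  have X_swap k l : X k l = Num.conj (X (sg k) (sg l)).
    rewrite !mxE /sg /E !enum_rankK rmorphM fmorphV rmorphD /= !dconj c_kms.
    have dsw p : d (sw p) = (d p)^-1 by rewrite /d /= invf_div.
    rewrite !dsw.
    have := dd0 (enum_val k) (enum_val l); have := d_gt0 (enum_val k); have := d_gt0 (enum_val l).
    move=> /lt0r_neq0 h1 /lt0r_neq0 h2 h3; field.
    by rewrite h1 h2 addrC h3.
  have P_swap k l : P k l = Num.conj (P (sg k) (sg l)).
    rewrite !mxE !big_ord1 !mxE /sg /E !enum_rankK /= rmorphB rmorphM rmorphM /= fmorphV !conjC_nat.
    rewrite rmorph_nat (inj_eq enum_rank_inj) (inj_eq (inv_inj swK)) (inj_eq enum_val_inj).
    by rewrite ![_.2 == _]eq_sym.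
  rewrite !mxE rmorph_sum (reindex_inj (inv_inj sgK)) /=; apply: eq_bigr => k _.
  rewrite rmorphM /= [P _ j]P_swap sgK; congr (_ * _).
  rewrite !mxE rmorph_sum (reindex_inj (inv_inj sgK)) /=; apply: eq_bigr => l _.
  by rewrite rmorphM /= P_swap X_swap !sgK.
have {YE} [g [h YE]] := YE.
(* Y is unchanged when each [w0 j] is replaced by its adjoint, so it is also
   the sum over the real and imaginary parts of the [w0 j]. *)
pose w0 j : 'M[C]_n := \matrix_(l, b) W (enum_rank (l, b)) j.
pose w (jb : 'I_N * bool) :=
  if jb.2 then 2%:R^-1 *: (w0 jb.1 + (w0 jb.1) ^t*)
  else ('i / 2%:R) *: (w0 jb.1 - (w0 jb.1) ^t*).
exists ('I_N * bool)%type, w, (fun p => g p * (d p + 1)), (fun q => h q * (1 + d q)).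
have conj2 : Num.conj (2%:R^-1 : C) = 2%:R^-1 by rewrite fmorphV rmorph_nat.
split=> [[j []]|[l b] [k a]]; rewrite /w /=.
- by rewrite adjmxZ adjmxD trmxCK addrC conj2.
- by rewrite adjmxZ adjmxB trmxCK rmorphM /= conjCi conj2 mulNr scaleNr -scalerN opprB.
rewrite -(pair_bigA _ (fun j (b0 : bool) => (if b0 then 2%:R^-1 *: (w0 j + (w0 j) ^t*)
  else ('i / 2%:R) *: (w0 j - (w0 j) ^t*)) l b * Num.conj ((if b0 then 2%:R^-1 *: (w0 j + (w0 j) ^t*)
  else ('i / 2%:R) *: (w0 j - (w0 j) ^t*)) k a) * (d (l, b) + d (k, a)))) /=.
have Ysum p q : Y (enum_rank p) (enum_rank q) = \sum_j w0 j p.1 p.2 * Num.conj (w0 j q.1 q.2).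
  by rewrite eW mxE; apply: eq_bigr => j _; rewrite adjmxE !mxE; case: p q => [? ?] [? ?].
transitivity (Y (enum_rank (l, b)) (enum_rank (k, a)) * (d (l, b) + d (k, a))).
  have -> : Y (enum_rank (l, b)) (enum_rank (k, a)) =
     2%:R^-1 * (Y (enum_rank (l, b)) (enum_rank (k, a))
       + Num.conj (Y (enum_rank (b, l)) (enum_rank (a, k)))).
    have := Y_swap (enum_rank (l, b)) (enum_rank (k, a)).
    by rewrite /sg /E !enum_rankK /= => <-; field.
  rewrite !Ysum rmorph_sum -big_split /= mulr_sumr mulr_suml; apply: eq_bigr => j _.
  rewrite big_bool /= !mxE !rmorphM /= ?rmorphD ?rmorphN /= ?conjCK ?rmorphM ?rmorphD ?rmorphN /= ?conjCK ?conjCi ?conj2.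
  have i2 : 'i * 'i = -1 :> C by rewrite -expr2 sqrCi.
  rewrite -mulrDl; congr (_ * _).
  set x := W _ j; set y := Num.conj _; set z := Num.conj _; set t := W _ j.
  transitivity (2%:R^-1 * 2%:R^-1 * ((x + y) * (z + t) - ('i * 'i) * ((x - y) * (z - t)))); first by ring.
  by rewrite i2; field.
rewrite YE /=.
(* On the support of the Kronecker delta the weight [d] equals 1. *)
have -> : (l == b)%:R * (h (k, a) * (1 + d (k, a))) = (l == b)%:R * (h (k, a) * (d (l, b) + d (k, a))).
  by have [->|] := eqVneq l b; rewrite ?mul0r // /d /= divff ?gt_eqF.
have -> : g (l, b) * (d (l, b) + 1) * (k == a)%:R = g (l, b) * (d (l, b) + d (k, a)) * (k == a)%:R.
  by have [->|] := eqVneq k a; rewrite ?mulr0 // /d /= divff ?gt_eqF.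
have := dd0 (l, b) (k, a) => h0.
by field.
Qed.
End Lyap.

(** * Generators as sums of squares of commutators *)

Section Core.
Variables (C : numClosedFieldType) (n : nat).

Definition commx (w A : 'M[C]_n) := w *m A - A *m w.

(** The rank one blocks suffice: they form the product of the column of the a_k
    with its adjoint, and every positive block matrix is a sum of such ones. *)
Definition cond_completely_negative (L : 'M[C]_n -> 'M[C]_n) : Prop :=
  forall a x : 'I_n -> 'cV[C]_n,
    \sum_k ((x k) ^t* *m a k) 0 0 = 0 ->
    0 <= - \sum_k \sum_l ((x k) ^t* *m L (a k *m (a l) ^t*) *m x l) 0 0.

Lemma adj_commx w A : w ^t* = w -> (commx w A) ^t* = - commx w (A ^t*).
Proof. by move=> hw; rewrite /commx adjmxB !adjmxM hw opprB. Qed.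

Lemma central_scalar (Z : 'M[C]_n) : (forall B, Z *m B = B *m Z) ->
  forall k l, Z k l = if k == l then Z l l else 0.
Proof.
move=> h k l; have [->//|kl] := eqVneq k l.
have := congr1 (fun M : 'M[C]_n => M k l) (h (delta_mx l l)).
rewrite -[_ *m delta_mx _ _]mulmx1 -[delta_mx _ _ *m _]mul1mx mulmxA !mul_delta_mxE.
by rewrite mxE eqxx mulr1 mxE (negPf kl) mul0r.
Qed.

Lemma central_diag (Z : 'M[C]_n) : (forall B, Z *m B = B *m Z) ->
  forall k l, Z k k = Z l l.
Proof.
move=> h k l.
have := congr1 (fun M : 'M[C]_n => M k l) (h (delta_mx k l)).
rewrite -[_ *m delta_mx _ _]mulmx1 -[delta_mx _ _ *m _]mul1mx mulmxA !mul_delta_mxE.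
by rewrite !mxE !eqxx mulr1 mul1r.
Qed.

Lemma adj_delta m p k l : (delta_mx k l : 'M[C]_(m, p)) ^t* = delta_mx l k.
Proof. by apply/matrixP => i j; rewrite !mxE conjC_nat andbC. Qed.

Lemma mulmx_entry m (x z : 'cV[C]_m) (A : 'M[C]_m) :
  (x ^t* *m A *m z) 0 0 = \sum_b \sum_a Num.conj (x a 0) * A a b * z b 0.
Proof.
rewrite mxE; apply: eq_bigr => b _; rewrite mxE mulr_suml; apply: eq_bigr => a _.
by rewrite adjmxE.
Qed.

Lemma linear_delta_eq0 (f : 'M[C]_n -> 'M[C]_n) :
  (forall a X Y, f (a *: X + Y) = a *: f X + f Y) ->
  (forall k l, f (delta_mx k l) = 0) -> forall B, f B = 0.
Proof.
move=> flin fdelta B; have [f0 fD fZ] := linear_fun_morph flin.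
rewrite [B]matrix_sum_delta (big_morph f fD f0) big1 // => k _.
by rewrite (big_morph f fD f0) big1 // => l _; rewrite fZ fdelta scaler0.
Qed.

Variable s : 'I_n -> C.
Hypothesis s_gt0 : forall i, 0 < s i.
Let S : 'M[C]_n := diag_mx (\row_i s i).
Let Si : 'M[C]_n := diag_mx (\row_i (s i)^-1).

Let SSi : S *m Si = 1%:M.
Proof.
apply/matrixP => i j; rewrite /S mul_diag_mx !mxE mulrnAr.
by case: eqP => [->|//]; rewrite divff // gt_eqF.
Qed.

Let SiS : Si *m S = 1%:M. Proof. exact: mulmx1C SSi. Qed.

Let S_herm : S ^t* = S.
Proof. by apply: adj_diag_mx => i; rewrite mxE. Qed.

Let Si_herm : Si ^t* = Si.
Proof. by apply: adj_diag_mx => i; rewrite mxE invr_gt0. Qed.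

Let SME (A : 'M[C]_n) i j : (S *m A) i j = s i * A i j.
Proof. by rewrite mul_diag_mx !mxE. Qed.
Let MSE (A : 'M[C]_n) i j : (A *m S) i j = A i j * s j.
Proof. by rewrite mul_mx_diag !mxE. Qed.
Let SiME (A : 'M[C]_n) i j : (Si *m A) i j = (s i)^-1 * A i j.
Proof. by rewrite mul_diag_mx !mxE. Qed.
Let MSiE (A : 'M[C]_n) i j : (A *m Si) i j = A i j * (s j)^-1.
Proof. by rewrite mul_mx_diag !mxE. Qed.

Let MSSi m (A : 'M[C]_(m, n)) : A *m S *m Si = A.
Proof. by rewrite -mulmxA SSi mulmx1. Qed.
Let MSiS m (A : 'M[C]_(m, n)) : A *m Si *m S = A.
Proof. by rewrite -mulmxA SiS mulmx1. Qed.

(** Preserving adjoints means that the sum of K and its adjoint is central;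
    with it KMS symmetry says that S K S^-1 + K is central, hence scalar.  Its entries are
    (s_k / s_l + 1) K_kl with nonzero factors, so K is scalar too. *)
Lemma kms_symmetric_inner_derivation_eq0 K :
  (forall B, (commx K B) ^t* = commx K (B ^t*)) ->
  (forall A B, \tr ((commx K A) ^t* *m S *m B *m S) =
               \tr (A ^t* *m S *m commx K B *m S)) ->
  forall B, commx K B = 0.
Proof.
move=> hst hkms.
have hK B : K ^t* *m B - B *m K ^t* = - commx K B.
  by rewrite -[in RHS](trmxCK B) -hst /commx adjmxB !adjmxM !trmxCK opprB.
have eq1 B : - commx K (S *m B *m S) = S *m commx K B *m S.
  apply: mxtrace_inj => X; rewrite -hK.
  have := hkms (X ^t*) B; rewrite trmxCK /commx adjmxB !adjmxM trmxCK.
  rewrite !mulmxA => <-; rewrite !mulmxBl !mulmxBr !raddfB /= !mulmxA; congr (_ - _).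
  by rewrite -!mulmxA [in RHS]mxtrace_mulC -!mulmxA.
pose Z := S *m K *m Si + K; pose Z' := K + Si *m K *m S.
have eq2 B : Z *m B = B *m Z'.
  have := eq1 (Si *m B *m Si); rewrite /commx !mulmxA SSi mul1mx MSiS.
  rewrite mulmxBr mulmxBl !mulmxA MSSi !MSiS SSi mul1mx opprB => h.
  rewrite /Z /Z' mulmxDl mulmxDr !mulmxA.
  by apply/eqP; rewrite -subr_eq0; move/eqP: h; rewrite -subr_eq0 => /eqP h; apply/eqP;
     rewrite -[RHS]oppr0 -h; apply/matrixP => i j; rewrite !mxE; ring.
have ZZ : Z = Z' by rewrite -[Z]mulmx1 eq2 mul1mx.
have Zc B : Z *m B = B *m Z by rewrite {2}ZZ.
have ZE k l : Z k l = (s k / s l + 1) * K k l.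
  by rewrite /Z mxE MSiE SME; field; rewrite gt_eqF.
have K0 k l : k != l -> K k l = 0.
  move=> kl; have := central_scalar Zc k l; rewrite (negPf kl) ZE => /eqP.
  rewrite mulf_eq0 gt_eqF /=; first by move/eqP.
  by rewrite addr_gt0 ?ltr01 // divr_gt0.
have Kd k l : K k k = K l l.
  have := central_diag Zc k l; rewrite !ZE !divff ?gt_eqF // => /mulfI; apply.
  by rewrite gt_eqF // addr_gt0 ?ltr01.
move=> B; apply/matrixP => i j; rewrite /commx !mxE.
rewrite (bigD1 i) //= big1 => [|k ki]; last by rewrite K0 ?mul0r // eq_sym.
rewrite (bigD1 j) //= big1 => [|k ki]; last by rewrite K0 ?mulr0.
by rewrite !addr0 (Kd i j) mulrC subrr.
Qed.

(** The composite of the KMS adjoint of [commx w] with [commx w], for w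
    Hermitian. *)
Definition kms_square (w B : 'M[C]_n) :=
  Si *m w *m S *m commx w B - commx w B *m S *m w *m Si.

Lemma kms_form_square w A B : w ^t* = w ->
  \tr ((commx w A) ^t* *m S *m commx w B *m S) = \tr (A ^t* *m S *m kms_square w B *m S).
Proof.
move=> hw; rewrite adj_commx // /kms_square.
move: (commx w B) => X.
rewrite /commx opprB mulmxBr !mulmxBl !raddfB /= !mulmxA MSSi MSiS.
congr (_ - _).
by rewrite -!mulmxA [LHS]mxtrace_mulC -!mulmxA.
Qed.

Lemma adj_kms_square w B : w ^t* = w -> (kms_square w B) ^t* = kms_square w (B ^t*).
Proof.
move=> hw; rewrite /kms_square adjmxB !adjmxM S_herm Si_herm hw adj_commx //.
by rewrite !mulmxN !mulNmx opprK addrC !mulmxA.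
Qed.

Lemma kms_square1 w : kms_square w 1%:M = 0.
Proof. by rewrite /kms_square /commx mulmx1 mul1mx subrr !(mulmx0, mul0mx) subrr. Qed.

Theorem sum_of_square_commutators (L : 'M[C]_n -> 'M[C]_n) : (0 < n)%N ->
  (forall a X Y, L (a *: X + Y) = a *: L X + L Y) ->
  L 1%:M = 0 -> (forall A, L (A ^t*) = (L A) ^t*) ->
  (forall A B, \tr ((L A) ^t* *m S *m B *m S) = \tr (A ^t* *m S *m L B *m S)) ->
  cond_completely_negative L ->
  exists (I : finType) (w : I -> 'M[C]_n), (forall j, (w j) ^t* = w j) /\
   forall A B, \tr (A ^t* *m S *m L B *m S) =
     \sum_j \tr ((commx (w j) A) ^t* *m S *m commx (w j) B *m S).
Proof.
move=> n_gt0 Llin L1 Lst Lkms Lcn.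
(* The Choi matrix of [- L]: for a map sending B to v ^t* *m B *m v it would be
   v_p conj(v_q). *)
pose c (p q : 'I_n * 'I_n) := - L (delta_mx q.1 p.1) q.2 p.2.
have c_herm p q : c q p = Num.conj (c p q).
  by rewrite /c rmorphN /= -adjmxE -Lst adj_delta.
have c_kms p q : c p q = (s p.1 / s p.2) * (s q.1 / s q.2) *
    Num.conj (c (p.2, p.1) (q.2, q.1)).
  rewrite /c /=.
  have := Lkms (delta_mx q.2 p.2) (delta_mx q.1 p.1); rewrite adj_delta.
  rewrite mxtrace_mulC -!mulmxA [RHS]mxtrace_mulC !mulmxA !mxtrace_delta.
  rewrite !MSE !SME adjmxE rmorphN /= => h.
  have sn i : s i != 0 by rewrite gt_eqF.
  have -> : Num.conj (L (delta_mx q.2 p.2) q.1 p.1)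
      = s q.2 * L (delta_mx q.1 p.1) q.2 p.2 * s p.2 / (s p.1 * s q.1).
    by rewrite -h; field; rewrite !sn.
  by field; rewrite !sn.
have c_cp (y : 'I_n * 'I_n -> C) : \sum_m y (m, m) = 0 ->
   0 <= \sum_p \sum_q Num.conj (y p) * c p q * y q.
  move=> y0; have := Lcn (fun k => delta_mx k 0) (fun k => \col_b Num.conj (y (k, b))).
  rewrite (eq_bigr (fun k => y (k, k))) => [|k _]; last first.
    rewrite mxE (bigD1 k) //= big1 => [|j jk]; rewrite !mxE ?eqxx ?(negPf jk) ?mulr0 //.
    by rewrite addr0 mulr1 conjCK.
  move/(_ y0); congr (0 <= _).
  under eq_bigr => k _ do under eq_bigr => l _ do
    rewrite adj_delta mul_delta_mx mulmx_entry.
  rewrite exchange_big /= -sumrN.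
  transitivity (\sum_l \sum_b \sum_k \sum_a Num.conj (y (l, b)) * c (l, b) (k, a) * y (k, a)).
    apply: eq_bigr => l _; rewrite -sumrN [RHS]exchange_big /=; apply: eq_bigr => k _.
    rewrite -sumrN; apply: eq_bigr => b _; rewrite -sumrN; apply: eq_bigr => a _.
    by rewrite !mxE conjCK /c /=; ring.
  rewrite pair_bigA /=; apply: eq_bigr => -[l b] _ /=.
  by rewrite pair_bigA; apply: eq_bigr => -[].
have [I [w [g [h [w_herm wE]]]]] := lyapunov_kraus s_gt0 n_gt0 c_herm c_kms c_cp.
exists I, w; split=> // A B.
pose M B := \sum_j kms_square (w j) B - L B.
have [K [K' ME]] : exists K K', forall B, M B = K *m B + B *m K'.
  (* The terms of [kms_square] with B between two factors w cancel [- L] up to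
     the terms in g and h; the others are of the form K B + B G. *)
  pose G := \matrix_(a, k) (- h (k, a)); pose G' := \matrix_(l, b) (- g (l, b)).
  exists (\sum_j Si *m w j *m S *m w j + G), (\sum_j w j *m S *m w j *m Si + G') => B'.
  apply/eqP; rewrite -subr_eq0; apply/eqP; move: B'.
  apply: linear_delta_eq0 => [a X Y|k l].
    have sqlin w0 : kms_square w0 (a *: X + Y) = a *: kms_square w0 X + kms_square w0 Y.
      rewrite /kms_square; have -> : commx w0 (a *: X + Y) = a *: commx w0 X + commx w0 Y.
        rewrite /commx mulmxDr mulmxDl -scalemxAr -scalemxAl.
        by rewrite opprD addrACA -scalerBr.
      move: (commx w0 X) (commx w0 Y) => cX cY.
      by rewrite mulmxDr !mulmxDl -scalemxAr -!scalemxAl opprD addrACA -scalerBr.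
    rewrite /M Llin; under eq_bigr do rewrite sqlin.
    rewrite big_split /= -scaler_sumr; move: (_ + G) (_ + G') => V V'.
    rewrite mulmxDr mulmxDl -scalemxAr -scalemxAl.
    rewrite (addrACA (a *: (V *m X))) -scalerDr (opprD (a *: L X)) addrACA -scalerBr.
    by rewrite opprD addrACA -scalerBr.
  set E := delta_mx k l.
  have sqE j : kms_square (w j) E = Si *m w j *m S *m w j *m E + E *m (w j *m S *m w j *m Si)
      - (Si *m w j *m S *m E *m w j + w j *m E *m (S *m w j *m Si)).
    rewrite /kms_square /commx mulmxBr !mulmxBl !mulmxA.
    by rewrite opprB addrACA opprD.
  have KE : \sum_j (Si *m w j *m S *m E *m w j + w j *m E *m (S *m w j *m Si)) + L E
      + (G *m E + E *m G') = 0.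
    apply/matrixP => a b; rewrite mxE [X in X + _]mxE [X in _ + X]mxE [RHS]mxE summxE.
    rewrite -[G *m E]mulmx1 -[E *m G']mul1mx mulmxA !mul_delta_mxE !mxE.
    have := wE (l, b) (k, a); rewrite /c /= => wEe.
    have -> : L E a b = - (- L E a b) by rewrite opprK.
    rewrite (eq_bigr (fun j => w j l b * Num.conj (w j k a) * (s l / s b + s k / s a))) => [|j _].
      have -> : - L E a b = \sum_j w j l b * Num.conj (w j k a) * (s l / s b + s k / s a)
          - (l == b)%:R * h (k, a) - g (l, b) * (k == a)%:R.
        by rewrite wEe; ring.
      by rewrite (eq_sym a); ring.
    rewrite mxE !mul_delta_mxE !(MSE, SME, SiME, MSiE) -adjmxE w_herm.
    by field; rewrite !gt_eqF.
  rewrite /M; under eq_bigr do rewrite sqE.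
  rewrite sumrB big_split /= mulmxDl mulmxDr -mulmx_suml -mulmx_sumr.
  set x := _ *m E; set y := E *m _; set z := \sum_i _.
  by rewrite (addrACA x) -(addrA (x + y)) -opprD (opprD (x + y)) addrACA subrr add0r -opprD KE oppr0.
have M1 : M 1%:M = 0.
  by rewrite /M L1 subr0 big1 // => j _; rewrite kms_square1.
have K'E : K' = - K.
  by apply/eqP; rewrite -addr_eq0 addrC; apply/eqP; rewrite -M1 ME mulmx1 mul1mx.
have {K'E} ME X : M X = commx K X by rewrite ME K'E mulmxN.
have form X Y : \sum_j \tr ((commx (w j) X) ^t* *m S *m commx (w j) Y *m S)
    = \tr (X ^t* *m S *m (\sum_j kms_square (w j) Y) *m S).
  rewrite mulmx_sumr mulmx_suml linear_sum; apply: eq_bigr => j _.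
  by rewrite kms_form_square.
suff M0 : M B = 0.
  rewrite form; congr (\tr (_ *m _ *m _)); apply/esym/eqP.
  by rewrite -subr_eq0; apply/eqP.
rewrite ME; apply: kms_symmetric_inner_derivation_eq0 => [X|X Y]; rewrite -!ME.
  rewrite /M adjmxB adjmx_sum Lst; congr (_ - _); apply: eq_bigr => j _.
  by rewrite adj_kms_square.
rewrite /M adjmxB !mulmxBl mulmxBr mulmxBl !raddfB /= Lkms -form; congr (_ - _).
apply: (can_inj conjCK); rewrite -mxtrace_adj !adjmxM trmxCK S_herm.
transitivity (\tr (Y ^t* *m S *m (\sum_j kms_square (w j) X) *m S)).
  by rewrite mxtrace_mulC !mulmxA.
rewrite -form rmorph_sum /=; apply: eq_bigr => j _.
rewrite -mxtrace_adj !adjmxM trmxCK S_herm -!mulmxA [RHS]mxtrace_mulC.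
by rewrite !mulmxA.
Qed.
End Core.

(** * Polarization and preservation of adjoints *)

Section Pol.
Variable C : numClosedFieldType.

Lemma kms_symmetric_diff n (P A B TA TB : 'M[C]_n) c : Num.conj c = c ->
  \tr (TA ^t* *m P *m B *m P) = \tr (A ^t* *m P *m TB *m P) ->
  \tr ((c *: (A - TA)) ^t* *m P *m B *m P) = \tr (A ^t* *m P *m (c *: (B - TB)) *m P).
Proof.
move=> hc h; rewrite adjmxZ adjmxB hc -!scalemxAl -scalemxAr -scalemxAl !mxtraceZ.
by congr (_ * _); rewrite !mulmxBl mulmxBr mulmxBl !raddfB /= h.
Qed.

Lemma sesqui_polar (V : lmodType C) (f : V -> V -> C) :
  (forall u a v w, f u (a *: v + w) = a * f u v + f u w) ->
  (forall u a v w, f (a *: u + w) v = Num.conj a * f u v + f w v) ->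
  (forall v, f v v = 0) -> forall u v, f u v = 0.
Proof.
move=> fl fr f0 u v.
have h1 : f u v + f v u = 0.
  have := f0 (1 *: u + v); rewrite fl !fr !f0 conjC1 !mul1r add0r addr0 => <-.
  by rewrite addrC.
have h2 : - 'i * f u v + 'i * f v u = 0.
  by have := f0 ('i *: u + v); rewrite fl !fr !f0 conjCi mulr0 add0r addr0 addrC.
have h3 : 'i * (2%:R * f u v) = 0.
  have -> : 'i * (2%:R * f u v) = 'i * (f u v + f v u) - (- 'i * f u v + 'i * f v u) by ring.
  by rewrite h1 h2 mulr0 subr0.
move/eqP: h3; rewrite mulf_eq0 (negPf (neq0Ci _)) mulf_eq0 pnatr_eq0 /=.
by move/eqP.
Qed.

(** On the diagonal the forms of M and of its adjoint agree, positive numbers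
    being real; polarize. *)
Lemma psd_adj n (M : 'M[C]_n) :
  (forall v : 'cV[C]_n, 0 <= (v ^t* *m M *m v) 0 0) -> M ^t* = M.
Proof.
move=> h; apply/eqP; rewrite -subr_eq0; apply/eqP/matrixP => i j; rewrite [RHS]mxE.
pose f (u v : 'cV[C]_n) := (u ^t* *m (M ^t* - M) *m v) 0 0.
have f0 u v : f u v = 0.
  apply: (sesqui_polar (f := f)) => [x a y z|x a y z|x]; rewrite /f.
  - by rewrite mulmxDr -scalemxAr mxE [X in X + _]mxE.
  - by rewrite adjmxD adjmxZ !mulmxDl -!scalemxAl mxE [X in X + _]mxE.
  - have E : x ^t* *m M ^t* *m x = (x ^t* *m M *m x) ^t*.
      by rewrite !adjmxM trmxCK mulmxA.
    by rewrite mulmxBr mulmxBl E mxE [X in _ + X]mxE adjmxE geC0_conj ?subrr.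
have := f0 (delta_mx i 0) (delta_mx j 0).
by rewrite /f adj_delta -rowE -colE mxE mxE.
Qed.

(** The amount by which T fails to commute with adjoints, taken as a linear
    function of A, vanishes on the rank one projections up to scalars, hence by
    polarization on the matrix units. *)
Lemma adj_of_rank1 n (T : 'M[C]_n -> 'M[C]_n) :
  (forall a X Y, T (a *: X + Y) = a *: T X + T Y) ->
  (forall a : 'cV[C]_n, (T (a *m a ^t*)) ^t* = T (a *m a ^t*)) ->
  forall A, T (A ^t*) = (T A) ^t*.
Proof.
move=> Tl Th.
pose g A := T A - (T (A ^t*)) ^t*.
have gl a X Y : g (a *: X + Y) = a *: g X + g Y.
  rewrite /g adjmxD adjmxZ !Tl adjmxD adjmxZ conjCK opprD addrACA -scalerBr //.
have gd k l : g (delta_mx k l) = 0.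
  apply/matrixP => i j; rewrite [RHS]mxE.
  pose f (u v : 'cV[C]_n) := g (v *m u ^t*) i j.
  have f0 u v : f u v = 0.
    apply: (sesqui_polar (f := f)) => [x a y z|x a y z|x]; rewrite /f.
    - by rewrite mulmxDl -scalemxAl gl !mxE.
    - by rewrite adjmxD adjmxZ mulmxDr -scalemxAr gl !mxE.
    - by rewrite /g adjmxM trmxCK Th subrr mxE.
  have := f0 (delta_mx l 0) (delta_mx k 0).
  by rewrite /f adj_delta mul_delta_mx.
move=> A; have := linear_delta_eq0 gl gd A; rewrite /g => /eqP; rewrite subr_eq0 => /eqP ->.
by rewrite trmxCK.
Qed.
End Pol.

(** * Change of orthonormal basis *)

Section Transport.
Variables (C : numClosedFieldType) (n : nat) (s : 'I_n -> C) (U : 'M[C]_n).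
Hypothesis s_gt0 : forall i, 0 < s i.
Hypothesis U_unitary : U \is unitarymx.
Let S : 'M[C]_n := diag_mx (\row_i s i).
Let P : 'M[C]_n := U ^t* *m S *m U.

Let UK m (A : 'M[C]_(m, n)) : A *m U *m U ^t* = A.
Proof. by rewrite -mulmxA (unitarymxP _) ?mulmx1. Qed.

Let KU m (A : 'M[C]_(m, n)) : A *m U ^t* *m U = A.
Proof. by rewrite -mulmxA (mulmx1C (unitarymxP U_unitary)) mulmx1. Qed.

Lemma diag_conjM (a b : 'rV[C]_n) :
  (U ^t* *m diag_mx a *m U) *m (U ^t* *m diag_mx b *m U) =
  U ^t* *m diag_mx (\row_i (a 0 i * b 0 i)) *m U.
Proof.
rewrite !mulmxA UK -(mulmxA _ (diag_mx a)); congr (_ *m _ *m _).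
apply/matrixP => i j; rewrite mul_diag_mx !mxE mulrnAr.
by have [->|] := eqVneq i j.
Qed.

Let trace_conj X Y : \tr ((U *m X *m U ^t*) ^t* *m S *m (U *m Y *m U ^t*) *m S)
  = \tr (X ^t* *m P *m Y *m P).
Proof.
by rewrite !adjmxM trmxCK -!mulmxA [LHS]mxtrace_mulC /P !mulmxA.
Qed.

Let commx_conj w X : commx w (U *m X *m U ^t*) = U *m commx (U ^t* *m w *m U) X *m U ^t*.
Proof.
rewrite /commx mulmxBr mulmxBl !mulmxA UK -(mul1mx w) -(unitarymxP U_unitary).
by rewrite !mulmxA !KU.
Qed.

Theorem sum_of_square_commutators_conj (L : 'M[C]_n -> 'M[C]_n) : (0 < n)%N ->
  (forall a X Y, L (a *: X + Y) = a *: L X + L Y) ->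
  L 1%:M = 0 -> (forall A, L (A ^t*) = (L A) ^t*) ->
  (forall A B, \tr ((L A) ^t* *m P *m B *m P) = \tr (A ^t* *m P *m L B *m P)) ->
  cond_completely_negative L ->
  exists (I : finType) (w : I -> 'M[C]_n), (forall j, (w j) ^t* = w j) /\
   forall A B, \tr (A ^t* *m P *m L B *m P) =
     \sum_j \tr ((commx (w j) A) ^t* *m P *m commx (w j) B *m P).
Proof.
move=> n_gt0 Llin L1 Lst Lkms Lcn.
pose L' B := U *m L (U ^t* *m B *m U) *m U ^t*.
have conjE A : A = U *m (U ^t* *m A *m U) *m U ^t*.
  by rewrite !mulmxA UK (unitarymxP U_unitary) mul1mx.
have [|||A B|a x ax0|I [w [wh wE]]] := @sum_of_square_commutators _ _ _ s_gt0 L' n_gt0.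
- move=> a X Y; rewrite /L' mulmxDr mulmxDl -scalemxAr -scalemxAl Llin.
  by rewrite mulmxDr mulmxDl -scalemxAr -scalemxAl.
- by rewrite /L' mulmx1 (mulmx1C (unitarymxP U_unitary)) L1 mulmx0 mul0mx.
- by move=> A; rewrite /L' !adjmxM trmxCK -Lst !adjmxM trmxCK !mulmxA.
- have := Lkms (U ^t* *m A *m U) (U ^t* *m B *m U).
  by rewrite -(trace_conj (L _)) -(trace_conj (U ^t* *m A *m U)) -!conjE.
- rewrite /L'.
  have := Lcn (fun k => U ^t* *m a k) (fun k => U ^t* *m x k).
  under eq_bigr => k _ do rewrite adjmxM trmxCK mulmxA UK.
  move/(_ ax0); congr (0 <= - _); apply: eq_bigr => k _; apply: eq_bigr => l _.
  by rewrite !adjmxM trmxCK !mulmxA.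
exists I, (fun j => U ^t* *m w j *m U); split=> [j|A B].
  by rewrite !adjmxM trmxCK wh mulmxA.
have L'E : L' (U *m B *m U ^t*) = U *m L B *m U ^t*.
  by rewrite /L' !mulmxA KU (mulmx1C (unitarymxP U_unitary)) mul1mx.
rewrite -(trace_conj A) -L'E wE; apply: eq_bigr => j _.
by rewrite (commx_conj _ A) (commx_conj _ B) (trace_conj (commx _ A)).
Qed.
End Transport.

(** * The bimodule of families of commutators *)

Section Bimodule.
Variables (C : numClosedFieldType) (n : nat) (I : finType) (w : I -> 'M[C]_n).
Hypothesis w_herm : forall j, (w j) ^t* = w j.
Variables q qi : 'M[C]_n.
Hypothesis q_herm : q ^t* = q.
Hypothesis qK : qi *m q = 1%:M.
Local Notation M := 'M[C]_n.
Local Notation V := {ffun I -> M}.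

Definition hs (x y : V) : C := \sum_j \tr ((x j) ^t* *m y j).

Definition derv (A : M) : V := [ffun j => q *m commx (w j) A *m q].
Definition lact (A : M) (x : V) : V := [ffun j => A *m x j].
Definition ract (B : M) (x : V) : V := [ffun j => x j *m B].
(** The sign compensates the sign that [commx w], w Hermitian, acquires when it
    is exchanged with the adjoint. *)
Definition negadj (x : V) : V := [ffun j => - (x j) ^t*].

Lemma derv_linear : linear derv.
Proof.
move=> a A B; apply/ffunP => j; rewrite !ffunE.
have -> : commx (w j) (a *: A + B) = a *: commx (w j) A + commx (w j) B.
  by rewrite /commx mulmxDr mulmxDl -scalemxAr -scalemxAl opprD addrACA -scalerBr.
move: (commx (w j) A) (commx (w j) B) => X Y.
by rewrite mulmxDr mulmxDl -scalemxAr -scalemxAl.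
Qed.

Lemma lact_linear A a x y : lact A (a *: x + y) = a *: lact A x + lact A y.
Proof. by apply/ffunP => j; rewrite !ffunE mulmxDr -scalemxAr. Qed.

Lemma ract_linear A a x y : ract A (a *: x + y) = a *: ract A x + ract A y.
Proof. by apply/ffunP => j; rewrite !ffunE mulmxDl -scalemxAl. Qed.

Lemma negadj_antilinear a x y : negadj (a *: x + y) = Num.conj a *: negadj x + negadj y.
Proof. by apply/ffunP => j; rewrite !ffunE adjmxD adjmxZ opprD scalerN. Qed.

Lemma lactl a A B x : lact (a *: A + B) x = a *: lact A x + lact B x.
Proof. by apply/ffunP => j; rewrite !ffunE mulmxDl -scalemxAl. Qed.

Lemma ractl a A B x : ract (a *: A + B) x = a *: ract A x + ract B x.
Proof. by apply/ffunP => j; rewrite !ffunE mulmxDr -scalemxAr. Qed.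

Lemma qK' : q *m qi = 1%:M. Proof. exact: mulmx1C qK. Qed.

Lemma derv_twisted A B :
  derv (A *m B) = lact (q *m A *m qi) (derv B) + ract (qi *m B *m q) (derv A).
Proof.
apply/ffunP => j; rewrite !ffunE /commx.
have -> : q *m A *m qi *m (q *m (w j *m B - B *m w j) *m q) = q *m (A *m (w j *m B - B *m w j)) *m q.
  by rewrite !mulmxA -(mulmxA _ qi q) qK mulmx1.
have -> : q *m (w j *m A - A *m w j) *m q *m (qi *m B *m q) = q *m ((w j *m A - A *m w j) *m B) *m q.
  by rewrite !mulmxA -(mulmxA _ q qi) qK' mulmx1.
rewrite -mulmxDl -mulmxDr; congr (_ *m _ *m _).
by rewrite mulmxBr mulmxBl !mulmxA [RHS]addrC addrA subrK.
Qed.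

Lemma derv_adj A : derv (A ^t*) = negadj (derv A).
Proof.
apply/ffunP => j; rewrite !ffunE !adjmxM q_herm adj_commx //.
by rewrite mulNmx mulmxN opprK mulmxA.
Qed.

Lemma lactM A B x : lact (A *m B) x = lact A (lact B x).
Proof. by apply/ffunP => j; rewrite !ffunE mulmxA. Qed.
Lemma ractM A B x : ract (A *m B) x = ract B (ract A x).
Proof. by apply/ffunP => j; rewrite !ffunE mulmxA. Qed.
Lemma lractC A B x : lact A (ract B x) = ract B (lact A x).
Proof. by apply/ffunP => j; rewrite !ffunE mulmxA. Qed.
Lemma lact1 x : lact 1%:M x = x.
Proof. by apply/ffunP => j; rewrite !ffunE mul1mx. Qed.
Lemma ract1 x : ract 1%:M x = x.
Proof. by apply/ffunP => j; rewrite !ffunE mulmx1. Qed.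
Lemma negadjK x : negadj (negadj x) = x.
Proof. by apply/ffunP => j; rewrite !ffunE adjmxN opprK trmxCK. Qed.
Lemma negadj_lact A x : negadj (lact A x) = ract (A ^t*) (negadj x).
Proof. by apply/ffunP => j; rewrite !ffunE adjmxM mulNmx. Qed.
Lemma negadj_ract A x : negadj (ract A x) = lact (A ^t*) (negadj x).
Proof. by apply/ffunP => j; rewrite !ffunE adjmxM mulmxN. Qed.

Lemma hs_lact A x y : hs (lact (A ^t*) x) y = hs x (lact A y).
Proof.
by apply: eq_bigr => j _; rewrite !ffunE adjmxM trmxCK mulmxA.
Qed.

Lemma hs_ract A x y : hs (ract (A ^t*) x) y = hs x (ract A y).
Proof.
by apply: eq_bigr => j _; rewrite !ffunE adjmxM trmxCK -mulmxA mxtrace_mulC mulmxA.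
Qed.

Lemma hs_derv A B : hs (derv A) (derv B) =
  \sum_j \tr ((commx (w j) A) ^t* *m (q *m q) *m commx (w j) B *m (q *m q)).
Proof.
apply: eq_bigr => j _.
by rewrite !ffunE !adjmxM q_herm -!mulmxA [LHS]mxtrace_mulC !mulmxA.
Qed.

Lemma hs_negadj x : hs (negadj x) (negadj x) = hs x x.
Proof.
apply: eq_bigr => j _; rewrite !ffunE adjmxN trmxCK mulNmx mulmxN opprK.
by rewrite mxtrace_mulC.
Qed.

(** Matrix units suffice as generators, by bilinearity, and keep the list
    finite. *)
Definition span_gens := [seq lact (delta_mx p.1.1 p.1.2) (derv (delta_mx p.2.1 p.2.2)) |
  p : ('I_n * 'I_n) * ('I_n * 'I_n)].
Definition derv_span := <<span_gens>>%VS.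

Lemma mem_derv_span A B : lact A (derv B) \in derv_span.
Proof.
have [d0 dD dZ] := linear_fun_morph derv_linear.
have lin_l x := linear_fun_morph (fun a X Y => lactl a X Y x).
have [l0 lD lZ] : [/\ forall x, lact 0 x = 0,
    forall X Y x, lact (X + Y) x = lact X x + lact Y x
    & forall a X x, lact (a *: X) x = a *: lact X x].
  by split=> [x|X Y x|a X x]; have [h0 hD hZ] := lin_l x.
have lin_r X := linear_fun_morph (lact_linear X).
have [r0 rD rZ] : [/\ forall X, lact X 0 = 0,
    forall X x y, lact X (x + y) = lact X x + lact X y
    & forall X a x, lact X (a *: x) = a *: lact X x].
  by split=> [X|X x y|X a x]; have [h0 hD hZ] := lin_r X.
rewrite [A]matrix_sum_delta (big_morph (lact^~ _) (fun X Y => lD X Y _) (l0 _)).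
apply: memv_suml => i _; rewrite (big_morph (lact^~ _) (fun X Y => lD X Y _) (l0 _)).
apply: memv_suml => j _; rewrite lZ memvZ //.
rewrite [B]matrix_sum_delta (big_morph derv dD d0) (big_morph (lact _) (rD _) (r0 _)).
apply: memv_suml => k _; rewrite (big_morph derv dD d0) (big_morph (lact _) (rD _) (r0 _)).
apply: memv_suml => l _; rewrite dZ rZ memvZ //.
by apply: memv_span; apply/fintype.imageP; exists ((i, j), (k, l)).
Qed.

(** Stated for semilinear maps, so as to cover the anti-linear [negadj]. *)
Lemma derv_span_stable (s : C -> C) (f : V -> V) :
  s 1 = 1 -> (forall a x y, f (a *: x + y) = s a *: f x + f y) ->
  (forall A B, f (lact A (derv B)) \in derv_span) -> forall x, x \in derv_span -> f x \in derv_span.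
Proof.
move=> s1 fl fU x xU.
have f0 : f 0 = 0.
  by have := fl 1 0 0; rewrite scaler0 addr0 s1 scale1r => h; apply: (addrI (f 0)); rewrite -h addr0.
rewrite (@coord_span _ _ _ (in_tuple span_gens) x) //.
apply: (big_ind (fun y => f y \in derv_span)) => [|y z fy fz|k _]; first by rewrite f0 mem0v.
  by rewrite -[y]scale1r fl memvD ?memvZ.
rewrite -[_ *: _]addr0 fl f0 addr0 memvZ //.
have /fintype.imageP[p _ ->] : (in_tuple span_gens)`_k \in span_gens by rewrite mem_nth //.
exact: fU.
Qed.

End Bimodule.
Arguments hs {C n I} x y.

Local Open Scope classical_set_scope.
Local Open Scope complex_scope.
Local Open Scope sesquilinear_scope.
Local Open Scope ring_scope.

(** * Norms on matrices and on maps between them *)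

Section Norms.
Variable R : realType.

Lemma le_l2norm (I : finType) (x : I -> R) i : x i <= Num.sqrt (\sum_j x j ^+ 2).
Proof.
apply: le_trans (ler_norm _) _; rewrite -sqrtr_sqr ler_wsqrtr //.
by rewrite (bigD1 i) //= lerDl sumr_ge0 // => j _; apply: sqr_ge0.
Qed.

Lemma l2norm_le_l1norm (I : finType) (x : I -> R) : (forall i, 0 <= x i) ->
  Num.sqrt (\sum_j x j ^+ 2) <= \sum_j x j.
Proof.
move=> x0; have s0 (r : seq I) : 0 <= \sum_(j <- r) x j by apply: sumr_ge0.
rewrite -[leRHS]ger0_norm ?s0 // -sqrtr_sqr ler_wsqrtr //.
elim: (index_enum I) => [|i r IH]; first by rewrite !big_nil expr0n.
rewrite !big_cons sqrrD -addrA lerD2l; apply: le_trans IH _.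
by rewrite lerDr mulrn_wge0 // mulr_ge0.
Qed.

Lemma normc_ge0 (z : R[i]) : 0 <= normc z. Proof. by case: z => a b; apply: sqrtr_ge0. Qed.

Lemma normc_sum (I : Type) (r : seq I) (P : pred I) (F : I -> R[i]) :
  normc (\sum_(i <- r | P i) F i) <= \sum_(i <- r | P i) normc (F i).
Proof.
apply: (big_ind2 (fun x y => normc x <= y)) => [|x1 y1 x2 y2 h1 h2|//].
  by rewrite normc0.
by apply: le_trans (le_normcD _ _) _; apply: lerD.
Qed.

Lemma normc_le0 (z : R[i]) : normc z <= 0 -> z = 0.
Proof. by move=> h; apply: eq0_normc; apply/le_anti; rewrite h normc_ge0. Qed.

Lemma Re_conjM (z : R[i]) : complex.Re (Num.conj z * z) = normc z ^+ 2.
Proof.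
case: z => a b; rewrite /= sqr_sqrtr ?addr_ge0 ?sqr_ge0 //.
by rewrite mulNr opprK !expr2.
Qed.

Lemma Re_normc (z : R[i]) : `|complex.Re z| <= normc z.
Proof. by case: z => a b /=; rewrite -sqrtr_sqr ler_wsqrtr // lerDl sqr_ge0. Qed.

Lemma Im_normc (z : R[i]) : `|complex.Im z| <= normc z.
Proof. by case: z => a b /=; rewrite -sqrtr_sqr ler_wsqrtr // lerDr sqr_ge0. Qed.

Lemma normc_real (x : R) : normc x%:C = `|x|.
Proof. by rewrite /= expr0n addr0 sqrtr_sqr. Qed.

Lemma Re_sum (I : Type) (r : seq I) (P : pred I) (F : I -> R[i]) :
  complex.Re (\sum_(i <- r | P i) F i) = \sum_(i <- r | P i) complex.Re (F i).
Proof. by apply: (big_morph (@complex.Re R)) => // -[? ?] [? ?]. Qed.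

Lemma cvnormE n (v : 'cV[R[i]]_n) : cvnorm v = Num.sqrt (\sum_i normc (v i 0) ^+ 2).
Proof.
rewrite /cvnorm mxE Re_sum; congr Num.sqrt; apply: eq_bigr => i _.
by rewrite -Re_conjM !mxE.
Qed.

Lemma normc_le_cvnorm n (v : 'cV[R[i]]_n) i : normc (v i 0) <= cvnorm v.
Proof. by rewrite cvnormE (le_l2norm (fun i => normc (v i 0))). Qed.

Lemma cvnorm_le n (v : 'cV[R[i]]_n) : cvnorm v <= \sum_i normc (v i 0).
Proof. by rewrite cvnormE l2norm_le_l1norm // => i; apply: normc_ge0. Qed.

Definition l1norm n (A : 'M[R[i]]_n) : R := \sum_i \sum_j normc (A i j).

Lemma l1norm_ge0 n (A : 'M[R[i]]_n) : 0 <= l1norm A.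
Proof. by do 2 apply: sumr_ge0 => ? _; apply: normc_ge0. Qed.

Lemma cvnorm_mulmx n (A : 'M[R[i]]_n) v : cvnorm v <= 1 -> cvnorm (A *m v) <= l1norm A.
Proof.
move=> v1; apply: le_trans (cvnorm_le _) _; apply: ler_sum => i _.
rewrite mxE; apply: le_trans (normc_sum _ _ _) _; apply: ler_sum => j _.
rewrite normcM ler_piMr ?normc_ge0 //.
exact: le_trans (normc_le_cvnorm _ _) v1.
Qed.

(** A supremum in R bounds its set only when the set is bounded; hence the
    hypothesis of an a priori bound. *)
Lemma opnorm_ub (V W : lmodType R[i]) (NV : V -> R) (NW : W -> R) (T : V -> W) M :
  (forall x, NV x <= 1 -> NW (T x) <= M) ->
  forall x, NV x <= 1 -> NW (T x) <= opnorm NV NW T.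
Proof.
move=> h x x1; apply: sup_upper_bound; last by exists x.
split; first by exists (NW (T x)); exists x.
by exists M => _ [y /= y1 <-]; apply: h.
Qed.

Lemma opnorm_le (V W : lmodType R[i]) (NV : V -> R) (NW : W -> R) (T : V -> W) M :
  NV 0 <= 1 ->
  (forall x, NV x <= 1 -> NW (T x) <= M) -> opnorm NV NW T <= M.
Proof.
move=> h0 h; apply: sup_le_ub; first by exists (NW (T 0)); exists 0.
by move=> _ [y /= y1 <-]; apply: h.
Qed.

Lemma mxopnorm_le n (A : 'M[R[i]]_n) : mxopnorm A <= l1norm A.
Proof.
apply: opnorm_le => [|v]; last exact: cvnorm_mulmx.
by rewrite /cvnorm mulmx0 mxE sqrtr0 ler01.
Qed.

Lemma normc_le_mxopnorm n (A : 'M[R[i]]_n) i j : normc (A i j) <= mxopnorm A.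
Proof.
pose e : 'cV[R[i]]_n := delta_mx j 0.
have Ae : (A *m e) i 0 = A i j.
  rewrite mxE (bigD1 j) //= big1 => [|k kj]; rewrite !mxE ?eqxx ?(negPf kj) ?mulr0 //.
  by rewrite addr0 mulr1.
rewrite -Ae; apply: le_trans (normc_le_cvnorm _ _) _.
apply: (@opnorm_ub _ _ (@cvnorm R n) (@cvnorm R n) (fun v => A *m v) (l1norm A)).
  by move=> x; apply: cvnorm_mulmx.
apply: le_trans (cvnorm_le _) _; rewrite (bigD1 j) //= big1 => [|k kj].
  by rewrite mxE !eqxx addr0 normc_real normr1.
by rewrite mxE (negPf kj) normc0.
Qed.

(** Finite dimension enters here: the operator norm of a matrix lies between
    the modulus of any entry and the sum of all moduli, which makes the supremum
    that defines [supernorm] one of a bounded set. *)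
Lemma supernorm_entry n (A : 'M[R[i]]_n) : exists2 c : R, 0 <= c &
  forall T : 'M[R[i]]_n -> 'M[R[i]]_n,
  (forall a X Y, T (a *: X + Y) = a *: T X + T Y) ->
  forall i j, normc (T A i j) <= c * supernorm T.
Proof.
pose c : R := 1 + l1norm A.
have c_gt0 : 0 < c by rewrite ltr_wpDr ?l1norm_ge0.
exists c; first exact: ltW.
move=> T Tlin i j.
pose X := (c^-1)%:C *: A.
have X1 : mxopnorm X <= 1.
  apply: le_trans (mxopnorm_le _) _.
  have -> : l1norm X = c^-1 * l1norm A.
    rewrite mulr_sumr; apply: eq_bigr => k _; rewrite mulr_sumr; apply: eq_bigr => l _.
    by rewrite mxE normcM normc_real ger0_norm // invr_ge0 ltW.
  by rewrite ler_pdivrMl // mulr1 /c lerDr.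
have [T0 TD TZ] := linear_fun_morph Tlin.
have bnd Y : mxopnorm Y <= 1 -> mxopnorm (T Y) <=
    \sum_k \sum_l \sum_a \sum_b normc (T (delta_mx a b) k l).
  move=> Y1; apply: le_trans (mxopnorm_le _) _.
  apply: ler_sum => k _; apply: ler_sum => l _.
  have -> : T Y = \sum_a \sum_b Y a b *: T (delta_mx a b).
    rewrite {1}[Y]matrix_sum_delta (big_morph T TD T0); apply: eq_bigr => a _.
    by rewrite (big_morph T TD T0); apply: eq_bigr => b _.
  rewrite summxE; apply: le_trans (normc_sum _ _ _) _; apply: ler_sum => a _.
  rewrite summxE; apply: le_trans (normc_sum _ _ _) _; apply: ler_sum => b _.
  rewrite mxE normcM ler_piMl ?normc_ge0 //.
  exact: le_trans (normc_le_mxopnorm _ _ _) Y1.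
have -> : T A = c%:C *: T X.
  rewrite -TZ /X scalerA -rmorphM divff ?gt_eqF // rmorph1 scale1r //.
rewrite mxE normcM normc_real (ger0_norm (ltW c_gt0)) ler_pM2l //.
apply: le_trans (normc_le_mxopnorm _ _ _) _.
exact: (opnorm_ub bnd).
Qed.

End Norms.

(** * Entrywise limits at 0 from the right *)

Section Limits.
Variable R : realType.

(** Convergence of real and imaginary parts: comparison of limits is then a
    statement about the ordered field R. *)
Definition cvg0C (f : R -> R[i]) (l : R[i]) : Prop :=
  (complex.Re (f t) @[t --> 0^'+] --> complex.Re l) /\
  (complex.Im (f t) @[t --> 0^'+] --> complex.Im l).

Lemma cvg0C_cst l : cvg0C (fun=> l) l.
Proof. by split; apply: cvg_cst. Qed.

Lemma cvg0CD f g l m : cvg0C f l -> cvg0C g m -> cvg0C (fun t => f t + g t) (l + m).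
Proof.
move=> [f1 f2] [g1 g2]; split.
  have -> : complex.Re (l + m) = complex.Re l + complex.Re m by case: l m {f1 f2 g1 g2} => ? ? [].
  under eq_cvg => t do have -> : complex.Re (f t + g t) = complex.Re (f t) + complex.Re (g t) by case: (f t) (g t) => ? ? [].
  exact: cvgD.
have -> : complex.Im (l + m) = complex.Im l + complex.Im m by case: l m {f1 f2 g1 g2} => ? ? [].
under eq_cvg => t do have -> : complex.Im (f t + g t) = complex.Im (f t) + complex.Im (g t) by case: (f t) (g t) => ? ? [].
exact: cvgD.
Qed.

Lemma cvg0CM a f l : cvg0C f l -> cvg0C (fun t => a * f t) (a * l).
Proof.
move: a => [a b] [f1 f2]; split.
  have -> : complex.Re ((a +i* b) * l) = a * complex.Re l - b * complex.Im l by case: l {f1 f2}.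
  under eq_cvg => t do have -> : complex.Re ((a +i* b) * f t) = a * complex.Re (f t) - b * complex.Im (f t) by case: (f t).
  by apply: cvgB; apply: cvgMr.
have -> : complex.Im ((a +i* b) * l) = a * complex.Im l + b * complex.Re l by case: l {f1 f2}.
under eq_cvg => t do have -> : complex.Im ((a +i* b) * f t) = a * complex.Im (f t) + b * complex.Re (f t) by case: (f t).
by apply: cvgD; apply: cvgMr.
Qed.

Lemma cvg0C_conj f l : cvg0C f l -> cvg0C (fun t => Num.conj (f t)) (Num.conj l).
Proof.
move=> [f1 f2]; split.
  have -> : complex.Re (Num.conj l) = complex.Re l by case: l {f1 f2}.
  by under eq_cvg => t do have -> : complex.Re (Num.conj (f t)) = complex.Re (f t) by case: (f t).
have -> : complex.Im (Num.conj l) = - complex.Im l by case: l {f1 f2}.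
under eq_cvg => t do have -> : complex.Im (Num.conj (f t)) = - complex.Im (f t) by case: (f t).
exact: cvgN.
Qed.

Lemma cvg0C_sum (I : Type) (r : seq I) (P : pred I) (F : I -> R -> R[i]) (l : I -> R[i]) :
  (forall i, cvg0C (F i) (l i)) ->
  cvg0C (fun t => \sum_(i <- r | P i) F i t) (\sum_(i <- r | P i) l i).
Proof.
move=> h; elim: r => [|i r IH].
  by rewrite big_nil; under eq_fun do rewrite big_nil; apply: cvg0C_cst.
rewrite big_cons; under eq_fun do rewrite big_cons.
by case: (P i) => //; apply: cvg0CD.
Qed.

Lemma cvg0C_ge0 f l : cvg0C f l -> (forall t, 0 < t -> 0 <= f t) -> 0 <= l.
Proof.
move=> [f1 f2] h; rewrite lecE; apply/andP; split.
  apply/eqP; apply: (cvg_unique _ f2); first exact: norm_hausdorff.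
  apply: cvg_near_cst; near=> t.
  have : 0 <= f t by apply: h; near: t; apply: nbhs_right_gt.
  by rewrite lecE => /andP[/eqP].
have /= <- := cvg_lim (@norm_hausdorff _ _) f1.
apply: limr_ge; first by apply/cvg_ex; exists (complex.Re l).
near=> t; have : 0 <= f t by apply: h; near: t; apply: nbhs_right_gt.
by rewrite lecE => /andP[].
Unshelve. all: by end_near. Qed.

Lemma cvg0C_unique f g l m : cvg0C f l -> cvg0C g m ->
  (forall t, 0 < t -> f t = g t) -> l = m.
Proof.
move=> fl gm fg; apply/le_anti/andP; split; rewrite -subr_ge0.
  apply: (@cvg0C_ge0 (fun t => g t + (-1) * f t)) => [|t t0].
    by rewrite -[- l]mulN1r; apply: cvg0CD => //; apply: cvg0CM.
  by rewrite fg // mulN1r subrr.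
apply: (@cvg0C_ge0 (fun t => f t + (-1) * g t)) => [|t t0].
  by rewrite -[- m]mulN1r; apply: cvg0CD => //; apply: cvg0CM.
by rewrite fg // mulN1r subrr.
Qed.

Definition cvg0M m n (F : R -> 'M[R[i]]_(m, n)) (l : 'M[R[i]]_(m, n)) : Prop :=
  forall i j, cvg0C (fun t => F t i j) (l i j).

Lemma cvg0M_mull m n p (A : 'M[R[i]]_(m, n)) (F : R -> 'M[R[i]]_(n, p)) l :
  cvg0M F l -> cvg0M (fun t => A *m F t) (A *m l).
Proof.
move=> h i j; rewrite mxE; under eq_fun do rewrite mxE.
by apply: cvg0C_sum => k; apply: cvg0CM.
Qed.

Lemma cvg0M_mulr m n p (A : 'M[R[i]]_(n, p)) (F : R -> 'M[R[i]]_(m, n)) l :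
  cvg0M F l -> cvg0M (fun t => F t *m A) (l *m A).
Proof.
move=> h i j; rewrite mxE; under eq_fun do rewrite mxE.
apply: cvg0C_sum => k; rewrite mulrC; under eq_fun do rewrite mulrC.
exact: cvg0CM.
Qed.

Lemma cvg0M_adj m n (F : R -> 'M[R[i]]_(m, n)) l :
  cvg0M F l -> cvg0M (fun t => (F t) ^t*) (l ^t*).
Proof.
by move=> h i j; rewrite !mxE; under eq_fun do rewrite !mxE; apply: cvg0C_conj.
Qed.

Lemma cvg0M_trace n (F : R -> 'M[R[i]]_n) l :
  cvg0M F l -> cvg0C (fun t => \tr (F t)) (\tr l).
Proof. by move=> h; apply: cvg0C_sum. Qed.

End Limits.

(** * Properties of the generator *)

Section Generator.
Variables (R : realType) (n : nat) (rho : 'M[R[i]]_n).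
Variable Phi : R -> {linear 'M[R[i]]_n -> 'M[R[i]]_n}.
Hypothesis Phi_qms : quantum_markov_semigroup Phi.
Variable L : {linear 'M[R[i]]_n -> 'M[R[i]]_n}.
Hypothesis L_gen : is_generator Phi L.

Definition diffquot t A := (t^-1)%:C *: (A - Phi t A).

Lemma diffquot_linear t a X Y : diffquot t (a *: X + Y) = a *: diffquot t X + diffquot t Y.
Proof.
rewrite /diffquot (linearP (Phi t)) opprD addrACA -scalerBr scalerDr.
by rewrite !scalerA mulrC.
Qed.

Lemma generator_cvg A : cvg0M (diffquot ^~ A) (L A).
Proof.
move=> i j; have [c c0 hc] := supernorm_entry A.
pose T t A := diffquot t A - L A.
have Tlin t a X Y : T t (a *: X + Y) = a *: T t X + T t Y.
  by rewrite /T diffquot_linear (linearP L) opprD addrACA -scalerBr.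
have cv0 : c * supernorm (T t) @[t --> 0^'+] --> 0.
  by rewrite -[X in _ --> X](mulr0 c); apply: cvgMr.
have N0 : normc (diffquot t A i j - L A i j) @[t --> 0^'+] --> (0 : R).
  apply: squeeze_cvgr (cvg_cst _) cv0; near=> t.
  rewrite normc_ge0 /=; have := hc (T t) (Tlin t) i j.
  by rewrite /T !mxE.
have near_lt (e : R) : 0 < e -> \forall t \near 0^'+, normc (diffquot t A i j - L A i j) < e.
  move=> e0; move/cvgrPdistC_lt: N0 => /(_ e e0); apply: filterS => t.
  by rewrite subr0 ger0_norm ?normc_ge0.
split; apply/cvgrPdistC_lt => e /near_lt; apply: filterS => t h; apply: le_lt_trans h.
  apply: le_trans (Re_normc _).
  by case: (diffquot _ _ _ _) (L A i j) => [? ?] [? ?].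
apply: le_trans (Im_normc _).
by case: (diffquot _ _ _ _) (L A i j) => [? ?] [? ?].
Unshelve. all: by end_near. Qed.

Lemma generator1 : L 1%:M = 0.
Proof.
apply/matrixP => i j; rewrite [RHS]mxE.
apply: (cvg0C_unique (generator_cvg 1%:M i j) (cvg0C_cst 0)) => t t0.
have [/(_ t (ltW t0))[h _] _ _ _] := Phi_qms.
by rewrite /diffquot h subrr scaler0 mxE.
Qed.

(** The block matrix with rank one blocks is the product of the column of the
    a_i with its adjoint. *)
Lemma cp_blocks (T : 'M[R[i]]_n -> 'M[R[i]]_n) k (a x : 'I_k -> 'cV[R[i]]_n) :
  completely_positive T ->
  0 <= \sum_i \sum_j ((x i) ^t* *m T (a i *m (a j) ^t*) *m x j) 0 0.
Proof.
move=> cp.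
have adj_mxcol (y : 'I_k -> 'cV[R[i]]_n) : (\mxcol_i y i) ^t* = \mxrow_i (y i) ^t*.
  by rewrite tr_mxcol; apply/matrixP => i j; rewrite !mxE.
have form (M : 'I_k -> 'I_k -> 'M[R[i]]_n) (y : 'I_k -> 'cV[R[i]]_n) :
    ((\mxcol_i y i) ^t* *m (\mxblock_(i, j) M i j) *m (\mxcol_i y i)) 0 0
    = \sum_i \sum_j ((y i) ^t* *m M i j *m y j) 0 0.
  rewrite adj_mxcol mul_mxrow_mxblock mul_mxrow_mxcol summxE exchange_big /=.
  by apply: eq_bigr => j _; rewrite mulmx_suml summxE.
have psdX : psd (\mxblock_(i < k, j < k) (a i *m (a j) ^t*)).
  have -> : \mxblock_(i < k, j < k) (a i *m (a j) ^t*) = (\mxcol_i a i) *m (\mxcol_i a i) ^t*.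
    by rewrite adj_mxcol mul_mxcol_mxrow.
  move=> v; rewrite mulmxA -mulmxA.
  have -> : (\mxcol_i a i) ^t* *m v = (v ^t* *m \mxcol_i a i) ^t*.
    by rewrite adjmxM trmxCK.
  by rewrite mxE big_ord1 adjmxE mul_conjC_ge0.
have := cp _ _ psdX (\mxcol_i x i).
rewrite /amplification form; congr (0 <= _).
by apply: eq_bigr => i _; apply: eq_bigr => j _; rewrite mxblockK.
Qed.

Lemma cp_adj (T : {linear 'M[R[i]]_n -> 'M[R[i]]_n}) : completely_positive T ->
  forall A, T (A ^t*) = (T A) ^t*.
Proof.
move=> cp; apply: adj_of_rank1 => [a X Y|a]; first exact: linearP.
apply: psd_adj => v; have := cp_blocks (fun _ : 'I_1 => a) (fun=> v) cp.
by rewrite !big_ord1.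
Qed.

Lemma generator_adj A : L (A ^t*) = (L A) ^t*.
Proof.
apply/matrixP => i j.
apply: (cvg0C_unique (generator_cvg (A ^t*) i j)
  (cvg0M_adj (generator_cvg A) i j)) => t t0.
have [/(_ t (ltW t0))[_ cp] _ _ _] := Phi_qms.
congr (fun_of_matrix _ i j).
rewrite /diffquot adjmxZ adjmxB (cp_adj cp); congr (_ *: _).
by apply/esym/conj_Creal; apply/complex_realP; exists t^-1.
Qed.

Lemma generator_kms : (forall t, 0 <= t -> kms_symmetric rho (Phi t)) -> kms_symmetric rho L.
Proof.
move=> Phi_kms A B.
have kmsl : cvg0C (fun t => kms rho (diffquot t A) B) (kms rho (L A) B).
  apply: cvg0M_trace; apply: cvg0M_mulr; apply: cvg0M_mulr; apply: cvg0M_mulr.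
  exact/cvg0M_adj/generator_cvg.
have kmsr : cvg0C (fun t => kms rho A (diffquot t B)) (kms rho A (L B)).
  by apply: cvg0M_trace; apply: cvg0M_mulr; apply: cvg0M_mull; apply: generator_cvg.
apply: (cvg0C_unique kmsl kmsr) => t t0.
apply: kms_symmetric_diff; last exact: Phi_kms (ltW t0) A B.
by apply/conj_Creal; apply/complex_realP; exists t^-1.
Qed.

(** The identity map contributes to the difference quotient the square modulus
    of the sum of the inner products of x_k and a_k, which is zero; this leaves the nonnegative contribution of [Phi t]. *)
Lemma generator_cond_completely_negative : cond_completely_negative L.
Proof.
move=> a x ax0.
apply: (cvg0C_ge0 (f := fun t => - \sum_k \sum_l ((x k) ^t* *m diffquot t (a k *m (a l) ^t*) *m x l) 0 0)).
  rewrite -mulN1r; under eq_fun do rewrite -mulN1r.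
  apply: cvg0CM; apply: cvg0C_sum => k; apply: cvg0C_sum => l.
  exact/cvg0M_mulr/cvg0M_mull/generator_cvg.
move=> t t0.
have [/(_ t (ltW t0))[_ cp] _ _ _] := Phi_qms.
have -> : - \sum_k \sum_l ((x k) ^t* *m diffquot t (a k *m (a l) ^t*) *m x l) 0 0
   = (t^-1)%:C * \sum_k \sum_l ((x k) ^t* *m Phi t (a k *m (a l) ^t*) *m x l) 0 0
     - (t^-1)%:C * ((\sum_k ((x k) ^t* *m a k) 0 0) * (\sum_l ((a l) ^t* *m x l) 0 0)).
  rewrite mulr_suml !mulr_sumr -sumrN -sumrB; apply: eq_bigr => k _.
  rewrite !mulr_sumr -sumrN -sumrB; apply: eq_bigr => l _.
  rewrite /diffquot -scalemxAr -scalemxAl mulmxBr mulmxBl !mulmxA.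
  rewrite -(mulmxA _ ((a l) ^t*)) [X in - X]mxE [X in _ * X]mxE [X in _ * (X + _)]mxE big_ord1.
  by rewrite [X in _ * (_ + X)]mxE; ring.
rewrite ax0 mul0r mulr0 subr0 mulr_ge0 ?cp_blocks //.
by rewrite ler0c invr_ge0 ltW.
Qed.

End Generator.

(** * Subspaces of families of matrices as Hilbert spaces *)

Section RealComplete.
Variable R : realType.

Lemma real_cauchy_seq (u : nat -> R) :
  (forall e, 0 < e -> exists N : nat, forall p q : nat, (N <= p)%N -> (N <= q)%N -> `|u p - u q| < e) ->
  exists l, forall e, 0 < e -> exists N : nat, forall p : nat, (N <= p)%N -> `|u p - l| < e.
Proof.
move=> h.
have : cvg (u @ \oo).
  apply/cauchy_cvgP/cauchy_ballP => e e0; have [N hN] := h _ e0.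
  exists (u @` [set k | (N <= k)%N], u @` [set k | (N <= k)%N]) => /=.
    by split; exists N => // k /= Nk; exists k.
  by move=> [_ _] /= [[p Np <-] [q Nq <-]]; rewrite -ball_normE /= hN.
move=> /cvg_ex[l /cvgrPdistC_lt hl]; exists l => e /hl[N _ hN].
by exists N => p Np; apply: hN.
Qed.

Lemma complex_cauchy_seq (u : nat -> R[i]) :
  (forall e, 0 < e -> exists N : nat, forall p q : nat, (N <= p)%N -> (N <= q)%N -> normc (u p - u q) < e) ->
  exists l, forall e, 0 < e -> exists N : nat, forall p : nat, (N <= p)%N -> normc (u p - l) < e.
Proof.
move=> h.
have ReB (x y : R[i]) : complex.Re (x - y) = complex.Re x - complex.Re y by case: x y => ? ? [].
have ImB (x y : R[i]) : complex.Im (x - y) = complex.Im x - complex.Im y by case: x y => ? ? [].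
have [a ha] : exists l, forall e, 0 < e -> exists N : nat, forall p : nat, (N <= p)%N ->
    `|complex.Re (u p) - l| < e.
  apply: real_cauchy_seq => e /h[N hN]; exists N => p q Np Nq.
  by rewrite -ReB; apply: le_lt_trans (Re_normc _) (hN _ _ Np Nq).
have [b hb] : exists l, forall e, 0 < e -> exists N : nat, forall p : nat, (N <= p)%N ->
    `|complex.Im (u p) - l| < e.
  apply: real_cauchy_seq => e /h[N hN]; exists N => p q Np Nq.
  by rewrite -ImB; apply: le_lt_trans (Im_normc _) (hN _ _ Np Nq).
exists (a +i* b) => e e0.
have [|N hN] := ha (e / 2); first by rewrite divr_gt0.
have [|M hM] := hb (e / 2); first by rewrite divr_gt0.
exists (maxn N M) => p; rewrite geq_max => /andP[/hN h1 /hM h2].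
have -> : u p - (a +i* b) = (complex.Re (u p) - a)%:C + (0 +i* (complex.Im (u p) - b)).
  by case: (u p) => x y; apply/eqP; rewrite eq_complex /= addr0 add0r !eqxx.
apply: le_lt_trans (le_normcD _ _) _.
rewrite normc_real /= expr0n /= add0r sqrtr_sqr.
by rewrite [ltRHS](splitr e) ltrD.
Qed.

End RealComplete.

Section MxFamilies.
Variables (R : realType) (I : finType) (n : nat).
Local Notation V := {ffun I -> 'M[R[i]]_n}.
Local Notation T := (I * ('I_n * 'I_n))%type.

Definition entry (x : V) (t : T) : R[i] := x t.1 t.2.1 t.2.2.

Lemma hsE x y : hs x y = \sum_t Num.conj (entry x t) * entry y t.
Proof.
transitivity (\sum_j \sum_p Num.conj (entry x (j, p)) * entry y (j, p)).
  apply: eq_bigr => j _.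
  transitivity (\sum_l \sum_k Num.conj (entry x (j, (k, l))) * entry y (j, (k, l))).
    by apply: eq_bigr => l _; rewrite mxE; apply: eq_bigr => k _; rewrite adjmxE.
  by rewrite exchange_big pair_bigA; apply: eq_bigr => -[].
by rewrite pair_bigA; apply: eq_bigr => -[].
Qed.

Lemma entryD x y t : entry (x + y) t = entry x t + entry y t.
Proof. by rewrite /entry ffunE mxE. Qed.
Lemma entryZ a x t : entry (a *: x) t = a * entry x t.
Proof. by rewrite /entry ffunE mxE. Qed.
Lemma entryN x t : entry (- x) t = - entry x t.
Proof. by rewrite /entry ffunE mxE. Qed.
Lemma entryB x y t : entry (x - y) t = entry x t - entry y t.
Proof. by rewrite entryD entryN. Qed.

Lemma entry_inj x y : entry x =1 entry y -> x = y.
Proof. by move=> h; apply/ffunP => j; apply/matrixP => k l; exact: (h (j, (k, l))). Qed.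

Lemma hs_normE x : ip_norm hs x = Num.sqrt (\sum_t normc (entry x t) ^+ 2).
Proof.
rewrite /ip_norm hsE Re_sum; congr Num.sqrt; apply: eq_bigr => t _.
by rewrite -Re_conjM.
Qed.

Lemma normc_entry x t : normc (entry x t) <= ip_norm hs x.
Proof. by rewrite hs_normE (le_l2norm (fun t => normc (entry x t))). Qed.

Lemma hs_norm_le x : ip_norm hs x <= \sum_t normc (entry x t).
Proof. by rewrite hs_normE l2norm_le_l1norm // => t; apply: normc_ge0. Qed.

Definition unit_entry (t : T) : V := [ffun j => if j == t.1 then delta_mx t.2.1 t.2.2 else 0].

Lemma entry_unit t s : entry (unit_entry t) s = (s == t)%:R.
Proof.
case: t s => [j [k l]] [j' [k' l']]; rewrite /entry /unit_entry ffunE /= xpair_eqE xpair_eqE.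
by case: (j' == j); rewrite mxE.
Qed.

Lemma entry_sum (J : Type) (r : seq J) (P : pred J) (F : J -> V) s :
  entry (\sum_(k <- r | P k) F k) s = \sum_(k <- r | P k) entry (F k) s.
Proof.
apply: (big_morph (entry^~ s) (id1 := 0) (op1 := +%R)) => [y z|].
  exact: entryD.
by rewrite /entry ffunE mxE.
Qed.

Lemma entry_sum_unit (l : T -> R[i]) s : entry (\sum_t l t *: unit_entry t) s = l s.
Proof.
rewrite entry_sum (bigD1 s) //= big1 => [|t ts]; rewrite entryZ entry_unit.
  by rewrite eqxx mulr1 addr0.
by rewrite eq_sym (negPf ts) mulr0.
Qed.

Lemma sum_unit_entry x : x = \sum_t entry x t *: unit_entry t.
Proof. by apply: entry_inj => s; rewrite entry_sum_unit. Qed.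

Lemma hs_linear_bounded (f : V -> V) :
  (forall a x y, f (a *: x + y) = a *: f x + f y) ->
  exists M, forall x, ip_norm hs (f x) <= M * ip_norm hs x.
Proof.
move=> fl; exists (\sum_s \sum_t normc (entry (f (unit_entry t)) s)) => x.
have [f0 fD fZ] := linear_fun_morph fl.
apply: le_trans (hs_norm_le _) _; rewrite mulr_suml; apply: ler_sum => s _.
have -> : entry (f x) s = \sum_t entry x t * entry (f (unit_entry t)) s.
  rewrite {1}[x]sum_unit_entry (big_morph f fD f0) entry_sum.
  by apply: eq_bigr => t _; rewrite fZ entryZ.
apply: le_trans (normc_sum _ _ _) _; rewrite mulr_suml; apply: ler_sum => t _.
by rewrite normcM mulrC ler_wpM2l ?normc_ge0 // normc_entry.
Qed.

Variable U : {vspace V}.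
Local Notation H := (subvs_of U).
Definition subhs (x y : H) : R[i] := hs (vsval x) (vsval y).

Lemma hs_linear (a : R[i]) (x y z : V) : hs x (a *: y + z) = a * hs x y + hs x z.
Proof.
rewrite !hsE mulr_sumr -big_split; apply: eq_bigr => t _ /=.
by rewrite entryD entryZ; ring.
Qed.

Lemma hs_conj (x y : V) : hs y x = Num.conj (hs x y).
Proof.
rewrite !hsE rmorph_sum; apply: eq_bigr => t _ /=.
by rewrite rmorphM /= conjCK mulrC.
Qed.

Lemma hs_ge0 (x : V) : 0 <= hs x x.
Proof. by rewrite hsE sumr_ge0 // => t _; rewrite mulrC mul_conjC_ge0. Qed.

Lemma hs_eq0 (x : V) : hs x x = 0 -> x = 0.
Proof.
move=> x0; apply: entry_inj => t; rewrite [RHS]/entry ffunE mxE.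
apply: normc_le0; apply: le_trans (normc_entry _ _) _.
by rewrite /ip_norm x0 sqrtr0.
Qed.

(** A Cauchy sequence converges entrywise in the ambient space, and the
    projection onto the subspace, being bounded, carries its limit to a limit in
    the subspace. *)
Lemma subhs_complete : ip_complete subhs.
Proof.
move=> u hu.
have /choice[l hl] (t : T) : exists z : R[i], forall e : R, 0 < e ->
    exists N : nat, forall p : nat, (N <= p)%N -> normc (entry (vsval (u p)) t - z) < e.
  apply: complex_cauchy_seq => e /hu[N hN].
  exists N => p q Np Nq; apply: le_lt_trans (hN p q Np Nq).
  by rewrite -entryB; exact: (normc_entry (vsval (u p) - vsval (u q)) t).
pose v : V := \sum_t l t *: unit_entry t.
have entry_v s : entry v s = l s by apply: entry_sum_unit.
have hv e : 0 < e -> exists N : nat, forall p : nat, (N <= p)%N -> ip_norm hs (vsval (u p) - v) < e.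
  move=> e0; pose d := e / (#|{: T}|.+1)%:R.
  have d0 : 0 < d by rewrite divr_gt0 // ltr0n.
  have /choice[f hf] (t : T) : exists N : nat, forall p : nat, (N <= p)%N ->
      normc (entry (vsval (u p)) t - l t) < d by apply: hl.
  exists (\max_t f t)%N => p Np; apply: le_lt_trans (hs_norm_le _) _.
  apply: (@le_lt_trans _ _ (\sum_(t : T) d)).
    apply: ler_sum => t _; rewrite entryB entry_v; apply/ltW/hf.
    exact: leq_trans (leq_bigmax _) Np.
  rewrite sumr_const -mulr_natl /d mulrCA gtr_pMr // ltr_pdivrMr ?ltr0n // mul1r ltr_nat.
  exact: ltnSn.
have [M hM] := @hs_linear_bounded (projv U) (linearP (projv U)).
exists (vsproj U v) => e e0.
have M0 : 0 < `|M| + 1 by rewrite ltr_wpDl.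
have [|N hN] := hv (e / (`|M| + 1)); first by rewrite divr_gt0.
exists N => p /hN h.
have vE : vsval (u p - vsproj U v) = projv U (vsval (u p) - v).
  transitivity (projv U (vsval (u p)) - projv U v); last by rewrite linearB.
  by rewrite (projv_id (subvsP (u p))) [vsproj U]unlock.
have -> : ip_norm subhs (u p - vsproj U v) = ip_norm hs (projv U (vsval (u p) - v)).
  by rewrite -vE.
apply: le_lt_trans (hM _) _.
apply: (@le_lt_trans _ _ ((`|M| + 1) * ip_norm hs (vsval (u p) - v))); last first.
  by rewrite mulrC -ltr_pdivlMr.
rewrite ler_wpM2r ?sqrtr_ge0 //.
by apply: le_trans (ler_norm _) _; rewrite lerDl.
Qed.

Lemma subhs_eq0 (x : H) : subhs x x = 0 -> x = 0.
Proof. by move=> h; apply: subvs_inj; rewrite (hs_eq0 h). Qed.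

Definition subHilbert : hilbertSpace R :=
  @HilbertSpace R (subvs_of U) subhs
   (fun a x y z => hs_linear a (vsval x) (vsval y) (vsval z))
   (fun x y => hs_conj (vsval x) (vsval y))
   (fun x => hs_ge0 (vsval x))
   subhs_eq0
   subhs_complete.

End MxFamilies.

(** * The Hilbert bimodule and its derivation *)

Section BimoduleHilbert.
Variables (R : realType) (n : nat) (I : finType) (w : I -> 'M[R[i]]_n).
Hypothesis w_herm : forall j, (w j) ^t* = w j.
Variables q qi : 'M[R[i]]_n.
Hypothesis q_herm : q ^t* = q.
Hypothesis qK : qi *m q = 1%:M.
Local Notation M := 'M[R[i]]_n.
Local Notation V := {ffun I -> M}.
Local Notation U := (derv_span w q).
Local Notation H := (subHilbert U).

Lemma lact_derv_span A x : x \in U -> lact A x \in U.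
Proof.
apply: (derv_span_stable (s := id)) => // [a x0 y|B B']; first exact: lact_linear.
by rewrite -lactM mem_derv_span.
Qed.

(** With A written as the twist of another matrix, the Leibniz rule expresses
    delta(B) A by a value of delta and a left multiple of one. *)
Lemma ract_derv_span A x : x \in U -> ract A x \in U.
Proof.
apply: (derv_span_stable (s := id)) => // [a x0 y|B B']; first exact: ract_linear.
rewrite -lractC.
have -> : ract A (derv w q B') = derv w q (B' *m (q *m A *m qi)) - lact (q *m B' *m qi) (derv w q (q *m A *m qi)).
  have qA : qi *m (q *m A *m qi) *m q = A by rewrite !mulmxA qK mul1mx -mulmxA qK mulmx1.
  by rewrite (derv_twisted w qK) qA [X in X - _]addrC addrK.
rewrite -scaleN1r addrC lact_linear memvD ?memvZ //; last first.
  by rewrite mem_derv_span.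
by rewrite -lactM mem_derv_span.
Qed.

Lemma negadj_derv_span x : x \in U -> negadj x \in U.
Proof.
apply: (derv_span_stable (s := Num.conj)) => [|a x0 y|B B']; first exact: conjC1.
  exact: negadj_antilinear.
rewrite negadj_lact ract_derv_span // -derv_adj // -[derv _ _ _]lact1 mem_derv_span //.
Qed.

Definition span_left (A : M) (x : H) : H := vsproj U (lact A (vsval (x : subvs_of U))).
Definition span_right (A : M) (x : H) : H := vsproj U (ract A (vsval (x : subvs_of U))).
Definition span_conj (x : H) : H := vsproj U (negadj (vsval (x : subvs_of U))).
Definition span_derv : M -> H := fun A => vsproj U (derv w q A).

Lemma val_left A (x : subvs_of U) : vsval (span_left A x : subvs_of U) = lact A (vsval x).
Proof. by rewrite vsprojK // lact_derv_span // subvsP. Qed.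
Lemma val_right A (x : subvs_of U) : vsval (span_right A x : subvs_of U) = ract A (vsval x).
Proof. by rewrite vsprojK // ract_derv_span // subvsP. Qed.
Lemma val_conj (x : subvs_of U) : vsval (span_conj x : subvs_of U) = negadj (vsval x).
Proof. by rewrite vsprojK // negadj_derv_span // subvsP. Qed.
Lemma val_derv A : vsval (span_derv A : subvs_of U) = derv w q A.
Proof. by rewrite vsprojK // -[derv _ _ _]lact1 mem_derv_span. Qed.

Lemma hnormE (x : H) : hnorm x = ip_norm (@hs _ n I) (vsval (x : subvs_of U)).
Proof. by []. Qed.

Lemma adjoint_left A : adjoint (span_left A) = span_left (A ^t*).
Proof.
apply: adjointP => x y; change (subhs (span_left (A ^t*) x) y = subhs x (span_left A y)).
by rewrite /subhs !val_left hs_lact.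
Qed.

Lemma adjoint_right A : adjoint (span_right A) = span_right (A ^t*).
Proof.
apply: adjointP => x y; change (subhs (span_right (A ^t*) x) y = subhs x (span_right A y)).
by rewrite /subhs !val_right hs_ract.
Qed.

Lemma H_inj (x y : H) : vsval (x : subvs_of U) = vsval (y : subvs_of U) -> x = y.
Proof. exact: subvs_inj. Qed.

Lemma val_linear a (x y : H) : vsval (a *: x + y : subvs_of U) =
  a *: vsval (x : subvs_of U) + vsval (y : subvs_of U).
Proof. by []. Qed.

Lemma valD (x y : H) : vsval (x + y : subvs_of U) =
  vsval (x : subvs_of U) + vsval (y : subvs_of U).
Proof. by []. Qed.

Lemma span_derv_linear : linear span_derv.
Proof. by move=> a A B; rewrite /span_derv derv_linear linearP. Qed.

Lemma left_star_hom : unital_star_hom span_left.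
Proof.
split; last first.
  by move=> A B x; apply: H_inj; rewrite !val_left lactM.
split.
- move=> A; split.
    move=> a x y; apply: H_inj.
    by rewrite val_left val_linear lact_linear val_linear !val_left.
  have [K hK] := hs_linear_bounded (@lact_linear _ n I A); exists K => x.
  by rewrite !hnormE val_left.
- move=> a A B x; apply: H_inj.
  by rewrite val_left lactl val_linear !val_left.
- by move=> x; apply: H_inj; rewrite val_left lact1.
- by move=> A x; rewrite adjoint_left.
Qed.

Lemma right_star_antihom : unital_star_antihom span_right.
Proof.
split; last first.
  by move=> A B x; apply: H_inj; rewrite !val_right ractM.
split.
- move=> A; split.
    move=> a x y; apply: H_inj.
    by rewrite val_right val_linear ract_linear val_linear !val_right.
  have [K hK] := hs_linear_bounded (@ract_linear _ n I A); exists K => x.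
  by rewrite !hnormE val_right.
- move=> a A B x; apply: H_inj.
  by rewrite val_right ractl val_linear !val_right.
- by move=> x; apply: H_inj; rewrite val_right ract1.
- by move=> A x; rewrite adjoint_right.
Qed.

Lemma span_conj_involution : antilinear_isometric_involution span_conj.
Proof.
split.
- move=> a x y; apply: H_inj.
  by rewrite val_conj val_linear negadj_antilinear val_linear !val_conj.
- by move=> x; rewrite !hnormE val_conj /ip_norm hs_negadj.
- by move=> x; apply: H_inj; rewrite !val_conj negadjK.
Qed.

Lemma lin_span_derv : [set: H] = lin [set x | exists A B, x = span_left A (span_derv B)].
Proof.
apply/seteqP; split=> // x _.
have xU := subvsP (x : subvs_of U).
exists _, (fun k => coord (in_tuple (span_gens w q)) k (vsval (x : subvs_of U))),
  (fun k => vsproj U (in_tuple (span_gens w q))`_k); split=> [k|].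
  have /fintype.imageP[p _ ->] : (in_tuple (span_gens w q))`_k \in span_gens w q by rewrite mem_nth //.
  exists (delta_mx p.1.1 p.1.2), (delta_mx p.2.1 p.2.2).
  by apply: H_inj; rewrite val_left val_derv vsprojK // mem_derv_span.
transitivity (vsproj U (\sum_k coord (in_tuple (span_gens w q)) k (vsval (x : subvs_of U)) *:
    (in_tuple (span_gens w q))`_k)).
  by rewrite -coord_span // vsvalK.
by rewrite linear_sum; apply: eq_bigr => k _; rewrite linearZ.
Qed.

Lemma subhs_derv A B : subhs (span_derv A : subvs_of U) (span_derv B : subvs_of U) =
  hs (derv w q A) (derv w q B).
Proof. by congr (hs _ _); apply: val_derv. Qed.

HB.instance Definition _ := GRing.isLinear.Build R[i] M (subvs_of U) _ span_derv span_derv_linear.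

Lemma bimodule_realization (E : M -> M -> R[i]) :
  (forall A B, E A B = hs (derv w q A) (derv w q B)) ->
  exists (H : hilbertSpace R) (pi_l pi_r : M -> H -> H) (J : H -> H)
         (dlt : {linear M -> H}),
    [/\ unital_star_hom pi_l, unital_star_antihom pi_r
      & antilinear_isometric_involution J] /\
    [/\ forall A B xi, pi_l A (pi_r B xi) = pi_r B (pi_l A xi),
        forall A B xi, J (pi_l A (pi_r B xi)) =
          adjoint (pi_l B) (adjoint (pi_r A) (J xi)),
        forall A, dlt (A ^t*) = J (dlt A),
        forall A B, dlt (A *m B) =
          pi_l (q *m A *m qi) (dlt B) + pi_r (qi *m B *m q) (dlt A)
      & [set: H] = lin [set x | exists A B, x = pi_l A (dlt B)]] /\
    forall A B, E A B = hip (dlt A) (dlt B).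
Proof.
move=> EE; exists H, span_left, span_right, span_conj, (span_derv : {linear M -> subvs_of U}).
split; first by split; [apply: left_star_hom | apply: right_star_antihom | apply: span_conj_involution].
split; last first.
  move=> A B; change (E A B = subhs (span_derv A) (span_derv B)).
  by rewrite EE subhs_derv.
split.
- by move=> A B x; apply: H_inj; rewrite val_left !val_right val_left lractC.
- move=> A B x; rewrite adjoint_left adjoint_right; apply: H_inj.
  by rewrite val_conj !(val_left, val_right) val_conj negadj_lact negadj_ract lractC.
- move=> A; apply: H_inj; rewrite val_conj; apply: etrans (val_derv _) _.
  rewrite derv_adj //; congr (negadj _); exact/esym/val_derv.
- move=> A B; apply: H_inj; rewrite valD val_left val_right; apply: etrans (val_derv _) _.
  by rewrite (derv_twisted w qK); congr (lact _ _ + ract _ _); apply/esym/val_derv.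
- exact: lin_span_derv.
Qed.

End BimoduleHilbert.

(** * Real powers of the density matrix *)

Section RealPowers.
Variables (R : realType) (n : nat) (rho : 'M[R[i]]_n).

(** The eigenvalues of rho^r. *)
Definition eigpow (r : R) (i : 'I_n) : R[i] :=
  (expR (r * ln (complex.Re (spectral_diag rho 0 i))))%:C.

Lemma eigpow_gt0 r i : 0 < eigpow r i.
Proof. by rewrite ltcR expR_gt0. Qed.

Lemma mxpow_real r : mxpow rho r%:C =
  (spectralmx rho) ^t* *m diag_mx (\row_i eigpow r i) *m spectralmx rho.
Proof.
have Ui : invmx (spectralmx rho) = (spectralmx rho) ^t*.
  exact/invmx_unitary/spectral_unitarymx.
have eigE : map_mx (fun x => cexp (r%:C * (ln (complex.Re x))%:C)) (spectral_diag rho) =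
    \row_i eigpow r i.
  apply/rowP => i; rewrite !mxE /cexp /eigpow -rmorphM /= cos0 sin0.
  by rewrite mulr1.
by rewrite /mxpow /mxfun Ui eigE.
Qed.

Lemma mxpow_realD r t : mxpow rho r%:C *m mxpow rho t%:C = mxpow rho (r + t)%:C.
Proof.
have eigM : \row_i ((\row_i eigpow r i) 0 i * (\row_i eigpow t i) 0 i) = \row_i eigpow (r + t) i.
  by apply/rowP => i; rewrite !mxE /eigpow -rmorphM /= mulrDl expRD.
rewrite (mxpow_real r) (mxpow_real t) (mxpow_real (r + t)) -eigM.
exact: (diag_conjM (spectral_unitarymx rho)).
Qed.

Lemma mxpow0 : mxpow rho 0%:C = 1%:M.
Proof.
rewrite mxpow_real; have -> : diag_mx (\row_i eigpow 0 i) = 1%:M.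
  by apply/matrixP => i j; rewrite !mxE /eigpow mul0r expR0.
by rewrite mulmx1; apply/mulmx1C/unitarymxP/spectral_unitarymx.
Qed.

Lemma mxpow_real_adj r : (mxpow rho r%:C) ^t* = mxpow rho r%:C.
Proof.
rewrite mxpow_real !adjmxM trmxCK adj_diag_mx ?mulmxA // => i.
by rewrite mxE eigpow_gt0.
Qed.

End RealPowers.

Theorem theorem2p4 (R : realType) (n : nat) (rho : 'M[R[i]]_n)
    (rho_density : density rho) (rho_unit : rho \in unitmx)
    (Phi : R -> {linear 'M[R[i]]_n -> 'M[R[i]]_n})
    (Phi_qms : quantum_markov_semigroup Phi)
    (Phi_kms : forall t : R, 0 <= t -> kms_symmetric rho (Phi t))
    (L : {linear 'M[R[i]]_n -> 'M[R[i]]_n})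
    (L_gen : is_generator Phi L) :
  exists (H : hilbertSpace R) (pi_l pi_r : 'M[R[i]]_n -> H -> H) (J : H -> H)
         (delta : {linear 'M[R[i]]_n -> H}),
    [/\ unital_star_hom pi_l, unital_star_antihom pi_r
      & antilinear_isometric_involution J] /\
    [/\ forall A B xi, pi_l A (pi_r B xi) = pi_r B (pi_l A xi),
        forall A B xi, J (pi_l A (pi_r B xi)) =
          adjoint (pi_l B) (adjoint (pi_r A) (J xi)),
        forall A, delta (A ^t*) = J (delta A),
        forall A B, delta (A *m B) =
          pi_l (sigma rho (- 'i%C / 4%:R) A) (delta B)
          + pi_r (sigma rho ('i%C / 4%:R) B) (delta A)
      & [set: H] = lin [set x | exists A B, x = pi_l A (delta B)]] /\
    forall A B, kms rho A (L B) = hip (delta A) (delta B).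
Proof.
have n_gt0 : (0 < n)%N.
  rewrite lt0n; apply/eqP => n0; have [_] := rho_density.
  rewrite /mxtrace big1 => [/esym/eqP|[m m_lt] _]; first by rewrite oner_eq0.
  by exfalso; move: m_lt; rewrite n0.
pose q := mxpow rho (4^-1 : R)%:C; pose qi := mxpow rho (- 4^-1 : R)%:C.
have qiq : qi *m q = 1%:M by rewrite /qi /q mxpow_realD addNr mxpow0.
have half : (2%:R^-1 : R[i]) = (2^-1 : R)%:C by rewrite fmorphV rmorph_nat.
have quarter : (4%:R^-1 : R[i]) = (4^-1 : R)%:C by rewrite fmorphV rmorph_nat.
have qq : mxpow rho 2%:R^-1 = q *m q.
  by rewrite half /q mxpow_realD; congr (mxpow rho _%:C); field.
have ii : ('i%C : R[i]) * 'i%C = -1 by rewrite -expr2 sqr_i.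
have argl : ('i%C : R[i]) * (- 'i%C / 4%:R) = (4^-1 : R)%:C.
  by rewrite mulrA mulrN ii opprK mul1r quarter.
have argr : ('i%C : R[i]) * ('i%C / 4%:R) = (- 4^-1 : R)%:C.
  by rewrite mulrA ii mulN1r quarter rmorphN.
have oppq : - (4^-1 : R)%:C = (- 4^-1 : R)%:C by rewrite rmorphN.
have oppNq : - (- 4^-1 : R)%:C = (4^-1 : R)%:C by rewrite rmorphN opprK.
have sigl A : sigma rho (- 'i%C / 4%:R) A = q *m A *m qi.
  rewrite /sigma argl oppq; reflexivity.
have sigr A : sigma rho ('i%C / 4%:R) A = qi *m A *m q.
  rewrite /sigma argr oppNq; reflexivity.
have Lkms := generator_kms L_gen Phi_kms.
(* P stands for the square root of rho, to be read as q *m q afterwards. *)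
have squares P : P = mxpow rho 2%:R^-1 ->
    exists (I : finType) (w : I -> 'M[R[i]]_n), (forall j, (w j) ^t* = w j) /\
    forall A B, kms rho A (L B) =
      \sum_j \tr ((commx (w j) A) ^t* *m P *m commx (w j) B *m P).
  move=> ->; move: Lkms; rewrite /kms_symmetric /kms half mxpow_real => Lkms.
  apply: sum_of_square_commutators_conj n_gt0 _ _ _ Lkms _.
  - exact: eigpow_gt0.
  - exact: spectral_unitarymx.
  - exact: linearP.
  - exact: (generator1 Phi_qms L_gen).
  - exact: (generator_adj Phi_qms L_gen).
  - exact: (generator_cond_completely_negative Phi_qms L_gen).
have [I [w [w_herm wE]]] := squares _ (esym qq).
have q_herm : q ^t* = q by apply: mxpow_real_adj.
have kmsE A B : kms rho A (L B) = hs (derv w q A) (derv w q B).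
  exact: etrans (wE A B) (esym (hs_derv w q_herm A B)).
have [H [pl [pr [J [dlt [h1 [[h2 h3 h4 h5 h6] h7]]]]]]] :=
  bimodule_realization w_herm q_herm qiq kmsE.
exists H, pl, pr, J, dlt; split; first exact: h1.
split; last exact: h7.
split; [exact: h2 | exact: h3 | exact: h4 | move=> A B | exact: h6].
rewrite (h5 A B).
set X := sigma _ _ A; set Y := sigma _ _ B.
have eX : X = q *m A *m qi by exact: (sigl A).
have eY : Y = qi *m B *m q by exact: (sigr B).
by move: eX eY; move: X Y => X Y -> ->.
Qed.
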